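(* Let $A$, $B$, $C$ be SMLC $*$-algebras, where $B$ and $C$ have the inverse square root property. Let $f:A\times[0,\infty)\to B$ and $g:B\times[0,\infty)\to C$ be pointwise bounded asymptotic morphisms (PBAMs) satisfying conditions C1 and C3 below. Then for every valid reparameterisation $\phi$ for $f$ and $g$, $$\mathcal U(g\circ_\phi f)=\mathcal U(g)\circ\mathcal U(f)\in[\mathcal U(A),\mathcal U(C)].$$ C1: For all $a\in A$ and all $\nu>0$ there are $\xi>0$ and $Q'\ge0$ such that for all $t\ge Q'$ there is $S'\ge0$ such that for all $b\in B$ and $s\ge S'$: $d(f_t(a),b)<\xi$ implies $d(g_s(f_t(a)),g_s(b))<\nu$. C3: For all $a\in A$ and all $n\in\mathbb N$ there are $Q_n\ge0$ and $M_n\ge0$ such that for all $t\ge Q_n$ there is $S_n\ge0$ such that for all $s\ge S_n$: $|g_s(f_t(a))|_n\le M_n$.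
   Context: An SMLC $*$-algebra is a separable metrisable locally convex complex $*$-algebra with continuous multiplication and $*$-operation. Its topology is given by seminorms $|\cdot|_0,|\cdot|_1,\dots$ and by a translation invariant metric $d$; the seminorms are chosen so that $|b|_n\le|b|_{n+1}$, $|b^*|_n\le|b|_{n+1}$ and $|bb'|_n\le|b|_{n+1}|b'|_{n+1}$. No unit is assumed. Write $a\bullet b=a+b+ab$ (associative, with two-sided unit $0$), and $\mathcal U(A)=\{u\in A:u\bullet u^*=u^*\bullet u=0\}$ with the subspace topology. An element $a$ is $\bullet$-invertible if there is $a'$ with $a\bullet a'=a'\bullet a=0$. $[X,Y]$ denotes the set of homotopy classes of continuous maps $X\to Y$. Inverse square root property for a topological $*$-algebra $B$: with $B_{sad}=\{b\in B:b^*=b\}$, there are a convex open set $V_B\subset B_{sad}$ (open in $B_{sad}$) containing $0$ and a continuous function $\vartheta_B:V_B\to B_{sad}$ such that for all $b\in V_B$: (1) $b\bullet\vartheta_B(b)=\vartheta_B(b)\bullet b$; (2) $b\bullet(\vartheta_B(b)\bullet\vartheta_B(b))=0$; (3) $b$ is $\bullet$-invertible; and (4) $\vartheta_B(0)=0$. Fix such data $(V_B,\vartheta_B)$ and $(V_C,\vartheta_C)$. PBAM: a continuous function $f:A\times[0,\infty)\to B$, $(a,t)\mapsto f_t(a)$, such that (a) for all $a\in A$ and $n\in\mathbb N$ the set $\{|f_t(a)|_n:t\ge0\}$ is bounded; (b) $f$ is strongly asymptotically continuous: for all $\epsilon>0$ and $a\in A$ there are $\eta>0$ and $P\ge0$ such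 that for all $a'\in A$ with $d(a,a')<\eta$ and all $t\ge P$, $d(f_t(a),f_t(a'))<\epsilon$; and, as $t\to\infty$, for all $a,a'\in A$, $\lambda\in\mathbb C$: (c) $f_t(a)^*-f_t(a^* )\to0$; (d) $\lambda f_t(a)-f_t(\lambda a)\to0$; (e) $f_t(a)+f_t(a')-f_t(a+a')\to0$; (f) $f_t(a)f_t(a')-f_t(aa')\to0$. Induced class: for a PBAM $f:A\times[0,\infty)\to B$ with $B$ having the inverse square root property, $\mathcal U(f)\in[\mathcal U(A),\mathcal U(B)]$ is the homotopy class of $\tilde f_\alpha(v)=f_{\alpha(v)}(v)\bullet\vartheta_B(f_{\alpha(v)}(v)^*\bullet f_{\alpha(v)}(v))$, where $\alpha:\mathcal U(A)\to[0,\infty)$ is any continuous function such that for all $v\in\mathcal U(A)$ and $t\ge\alpha(v)$, $f_t(v)\bullet f_t(v)^*\in V_B$ and $f_t(v)^*\bullet f_t(v)\in V_B$ (such $\alpha$ exist and the class does not depend on the choice). Composition of homotopy classes is induced by composition of maps. PBA homotopy: two PBAMs $k,l:A\times[0,\infty)\to C$ are PBA homotopic if there is a PBAM $h:A\times[0,\infty)\to C([0,1],C)$ with $h_t(a)(0)=k_t(a)$ and $h_t(a)(1)=l_t(a)$, where $C([0,1],C)$ is the algebra of continuous functions $[0,1]\to C$ with pointwise operations and the supremum metric. Composition of PBAMs: for a continuous increasing $\phi:[0,\infty)\to[0,\infty)$ define $g\circ_\phi f:A\times[0,\infty)\to C$ by $(g\circ_\phi f)_t(a)=g_{\phi(t)}(f_t(a))$.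 The function $\phi$ is a valid reparameterisation for $f$ and $g$ if (a) $g\circ_\phi f$ is a PBAM, and (b) for every continuous increasing $\theta:[0,\infty)\to[0,\infty)$ with $\theta(t)\ge\phi(t)$ for all $t$, $g\circ_\theta f$ is also a PBAM and is PBA homotopic to $g\circ_\phi f$ via the PBAM $h:A\times[0,\infty)\to C([0,1],C)$ given by $h_t(a)(p)=g_{p\phi(t)+(1-p)\theta(t)}(f_t(a))$. Under C1 and C3 valid reparameterisations exist. *)

(* Defs.v *)
From HB Require Import structures.
From mathcomp Require Import all_boot all_order all_algebra.
From mathcomp Require Import all_classical all_reals all_analysis.
From mathcomp Require Import complex ring lra.

Set Implicit Arguments.
Unset Strict Implicit.
Unset Printing Implicit Defensive.

Import Order.TTheory GRing.Theory Num.Theory.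
Import numFieldTopology.Exports numFieldNormedType.Exports.

Local Open Scope classical_set_scope.
Local Open Scope ring_scope.
Local Open Scope complex_scope.

(* No unit is assumed, hence no ring structure. *)
HB.mixin Record Lmodule_isStarAlgebra (K : numClosedFieldType) A
    & GRing.Lmodule K A := {
  amul : A -> A -> A ;
  star : A -> A ;
  amulA : forall a b c, amul a (amul b c) = amul (amul a b) c ;
  amulDl : forall a b c, amul (a + b) c = amul a c + amul b c ;
  amulDr : forall a b c, amul a (b + c) = amul a b + amul a c ;
  amulZl : forall (k : K) a b, amul (k *: a) b = k *: amul a b ;
  amulZr : forall (k : K) a b, amul a (k *: b) = k *: amul a b ;
  starK : forall a, star (star a) = a ;
  starD : forall a b, star (a + b) = star a + star b ;
  starZ : forall (k : K) a, star (k *: a) = Num.conj k *: star a ;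
  starM : forall a b, star (amul a b) = amul (star b) (star a)
}.

#[short(type="starAlgType")]
HB.structure Definition StarAlgebra (K : numClosedFieldType) :=
  {A of GRing.Lmodule K A & Lmodule_isStarAlgebra K A}.

(* The seminorms and the translation invariant metric are part of the         *)
(* structure. Since the seminorms increase, the balls of single seminorms     *)
(* form a base of neighbourhoods.                                             *)
HB.mixin Record Tvs_isMetrisedStarAlgebra (R : realType) A
    & Tvs R[i] A & StarAlgebra R[i] A := {
  snorm : nat -> A -> R ;
  dist : A -> A -> R ;
  snorm_ge0 : forall n a, 0 <= snorm n a ;
  snormD : forall n a b, snorm n (a + b) <= snorm n a + snorm n b ;
  snormZ : forall n (k : R[i]) a,
    (snorm n (k *: a))%:C = `|k| * (snorm n a)%:C ;
  snorm_le : forall n a, snorm n a <= snorm n.+1 a ;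
  snorm_star : forall n a, snorm n (star a) <= snorm n.+1 a ;
  snormM : forall n a b, snorm n (amul a b) <= snorm n.+1 a * snorm n.+1 b ;
  nbhs_snormP : forall (a : A) (U : set A), nbhs a U <->
    exists n (e : R), 0 < e /\ [set b | snorm n (b - a) < e] `<=` U ;
  distxx : forall a, dist a a = 0 ;
  dist_eq0 : forall a b, dist a b = 0 -> a = b ;
  distC : forall a b, dist a b = dist b a ;
  dist_triangle : forall b a c, dist a c <= dist a b + dist b c ;
  distD : forall a b c, dist (a + c) (b + c) = dist a b ;
  nbhs_distP : forall (a : A) (U : set A), nbhs a U <->
    exists e : R, 0 < e /\ [set b | dist a b < e] `<=` U ;
  amul_continuous : continuous (fun x : A * A => amul x.1 x.2) ;
  star_continuous : continuous (star : A -> A)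
}.

#[short(type="mlcStarAlgType")]
HB.structure Definition MLCStarAlgebra (R : realType) :=
  {A of Tvs R[i] A & StarAlgebra R[i] A & Tvs_isMetrisedStarAlgebra R A}.

HB.mixin Record isSeparable (T : Type) & Topological T := {
  separable : exists2 D : set T, countable D & dense D
}.

#[short(type="smlcStarAlgType")]
HB.structure Definition SMLCStarAlgebra (R : realType) :=
  {A of MLCStarAlgebra R A & isSeparable A}.

Section star_algebra_facts.
Context (K : numClosedFieldType) (A : starAlgType K).
Implicit Types a b : A.

Lemma amulNl a b : amul (- a) b = - amul a b.
Proof. by rewrite -scaleN1r amulZl scaleN1r. Qed.

Lemma amulNr a b : amul a (- b) = - amul a b.
Proof. by rewrite -scaleN1r amulZr scaleN1r. Qed.

Lemma starN a : star (- a) = - star a.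
Proof. by rewrite -scaleN1r starZ rmorphN1 scaleN1r. Qed.

End star_algebra_facts.

Section seminorm_facts.
Context (R : realType) (A : mlcStarAlgType R).
Implicit Types (a b c : A) (n : nat).

Lemma dist0 a b : dist a b = dist 0 (b - a).
Proof. by rewrite -(distD a b (- a)) subrr. Qed.

Lemma dist_ge0 a b : 0 <= dist a b.
Proof. by have := dist_triangle b a a; rewrite distxx (distC b a); lra. Qed.

Lemma distDD a b a' b' : dist (a + b) (a' + b') <= dist a a' + dist b b'.
Proof.
apply: (le_trans (dist_triangle (a' + b) _ _)).
by rewrite distD ![a' + _]addrC distD.
Qed.

Lemma snormZr n (k : R[i]) a : snorm n (k *: a) = complex.Re `|k| * snorm n a.
Proof. by have := snormZ n k a; rewrite normc_def -rmorphM => /complexI ->. Qed.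

Lemma snorm0 n : snorm n (0 : A) = 0.
Proof. by rewrite -(scale0r (0 : A)) snormZr normr0 mul0r. Qed.

Lemma snormN n a : snorm n (- a) = snorm n a.
Proof. by rewrite -scaleN1r snormZr normrN1 mul1r. Qed.

Lemma dist_continuous : continuous (fun x : A * A => dist x.1 x.2 : R).
Proof.
move=> [x y]; apply: (proj2 (cvgrPdist_lt _ _)) => e e0 /=.
have e20 : 0 < e / 2 by rewrite divr_gt0.
exists ([set x' | dist x x' < e / 2], [set y' | dist y y' < e / 2]) => /=.
  by split; apply/nbhs_distP; exists (e / 2); split => // z.
move=> [x' y'] /= [xx yy].
have := dist_triangle x' x y; have := dist_triangle y' x' y.
have := dist_triangle x x' y'; have := dist_triangle y x y'.
by rewrite (distC x' x) (distC y' y) ltr_norml; lra.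
Qed.

Lemma snorm_continuous n : continuous (snorm n : A -> R).
Proof.
move=> x; apply: (proj2 (cvgrPdist_lt _ _)) => e e0 /=.
apply/nbhs_snormP; exists n, e; split => // y /= xy.
have := snormD n (y - x) x; have := snormD n (x - y) y.
by rewrite !subrK -opprB snormN ltr_norml; lra.
Qed.

End seminorm_facts.

Notation unit_itv R := (set_type `[0%R, 1%R : R]%classic).

Section sup_unit_interval.
Context (R : realType).
Local Notation I := (unit_itv R).

(* The supremum is finite for continuous h, see `le_isup`. *)
Definition isup (h : I -> R) : R := sup (range h).

(* `I_proj` is the identity on [0, 1]. *)
Definition I_clamp (x : R) : R := Num.max 0 (Num.min x 1).

Lemma I_clampP x : I_clamp x \in (`[0, 1]%classic : set R).
Proof.
by rewrite inE /= in_itv /= /I_clamp le_max lexx ge_max ler01 ge_min lexx orbT.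
Qed.

Definition I_proj (x : R) : I :=
  @exist R (fun x => x \in `[0, 1]%classic) (I_clamp x) (I_clampP x).

Lemma isup_has_ub (h : I -> R) : continuous h -> has_ubound (range h).
Proof.
move=> hc; pose f (x : R) := h (I_proj x).
have fE (p : I) : f (val p) = h p.
  rewrite /f; congr h; apply: val_inj => /=; rewrite /I_clamp.
  case: p => x /=; rewrite inE /= in_itv /= => /andP[x0 x1].
  by rewrite min_l// max_r.
have fc : {within `[0, 1], continuous f}.
  apply/subspace_sigL_continuousP.
  suff -> : sigL `[0, 1] f = h by [].
  by apply/funext => p; rewrite -fE /sigL.
have [c _ cmax] := EVT_max ler01 fc.
exists (f c) => _ [p _ <-]; rewrite -fE; apply: cmax.
by have /set_mem := valP p.
Qed.

Lemma le_isup (h : I -> R) p : continuous h -> h p <= isup h.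
Proof. by move=> hc; apply: ub_le_sup; [exact: isup_has_ub|exists p]. Qed.

Lemma isup_le (h : I -> R) M : (forall p, h p <= M) -> isup h <= M.
Proof.
move=> hM; apply: ge_sup; last by move=> _ [p _ <-].
exists (h (I_proj 0)); by exists (I_proj 0).
Qed.

End sup_unit_interval.

Lemma continuous2_comp {T U V W : topologicalType}
    (f : T -> U) (g : T -> V) (h : U -> V -> W) :
  continuous f -> continuous g -> continuous (fun z : U * V => h z.1 z.2) ->
  continuous (fun x => h (f x) (g x)).
Proof.
move=> cf cg ch x.
apply: (@continuous2_cvg _ _ _ _ (nbhs x) _ f g h (f x) (g x)).
- exact: (ch (f x, g x)).
- exact: cf.
- exact: cg.
Qed.

(* The algebra C([0,1], C): its seminorms and its metric are the suprema over *)
(* [0, 1] of those of C, and it carries the topology of that metric.          *)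
Definition C01 (R : realType) (C : mlcStarAlgType R) : Type :=
  continuousType (unit_itv R) C.

Section C01_algebra.
Context (R : realType) (C : mlcStarAlgType R).
Local Notation I := (unit_itv R).
Implicit Types (f g : C01 C).

Definition C01_fun f : I -> C := f.
Coercion C01_fun : C01 >-> Funclass.

Definition C01_mk (h : I -> C) (hc : continuous h) : C01 C :=
  (mkcts hc : continuousType I C).

Lemma C01P f g : (forall p, f p = g p) -> f = g.
Proof. by move=> fg; apply/continuousEP. Qed.

Lemma C01_cts f : continuous (C01_fun f). Proof. exact: cts_fun. Qed.

HB.instance Definition _ := Choice.copy (C01 C) (continuousType I C).

Lemma C01_zero_cts : continuous (fun _ : I => 0 : C).
Proof. exact: cst_continuous. Qed.

Lemma C01_opp_cts f : continuous (fun p => - f p).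
Proof.
move=> p; apply: (@continuous_comp _ _ _ (C01_fun f) (fun x => - x)).
  exact: C01_cts.
exact: tvs.opp_continuous.
Qed.

Lemma C01_add_cts f g : continuous (fun p => f p + g p).
Proof.
apply: (@continuous2_comp I C C _ f g (fun x y => x + y)).
- exact: C01_cts.
- exact: C01_cts.
- exact: tvs.add_continuous.
Qed.

Lemma C01_scale_cts (k : R[i]) f : continuous (fun p => k *: f p).
Proof.
apply: (@continuous2_comp _ R[i]^o _ _ (fun=> k) _ (fun x y => x *: y)).
- exact: cst_continuous.
- exact: C01_cts.
- exact: tvs.scale_continuous.
Qed.

Lemma C01_mul_cts f g : continuous (fun p => amul (f p) (g p)).
Proof.
apply: (@continuous2_comp I C C _ f g (fun x y => amul x y)).
- exact: C01_cts.
- exact: C01_cts.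
- exact: amul_continuous.
Qed.

Lemma C01_star_cts f : continuous (fun p => star (f p)).
Proof.
move=> p; apply: (@continuous_comp _ _ _ (C01_fun f) star).
  exact: C01_cts.
exact: star_continuous.
Qed.

Definition C01_zero := C01_mk C01_zero_cts.
Definition C01_opp f := C01_mk (@C01_opp_cts f).
Definition C01_add f g := C01_mk (@C01_add_cts f g).
Definition C01_scale (k : R[i]) f := C01_mk (@C01_scale_cts k f).
Definition C01_mul f g := C01_mk (@C01_mul_cts f g).
Definition C01_star f := C01_mk (@C01_star_cts f).

Lemma C01_addA : associative C01_add.
Proof. by move=> f g h; apply: C01P => p; exact: addrA. Qed.
Lemma C01_addC : commutative C01_add.
Proof. by move=> f g; apply: C01P => p; exact: addrC. Qed.
Lemma C01_add0 : left_id C01_zero C01_add.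
Proof. by move=> f; apply: C01P => p; exact: add0r. Qed.
Lemma C01_addN : left_inverse C01_zero C01_opp C01_add.
Proof. by move=> f; apply: C01P => p; exact: addNr. Qed.

HB.instance Definition _ :=
  GRing.isZmodule.Build (C01 C) C01_addA C01_addC C01_add0 C01_addN.

Lemma C01_scaleA a b f : C01_scale a (C01_scale b f) = C01_scale (a * b) f.
Proof. by apply: C01P => p; exact: scalerA. Qed.
Lemma C01_scale1 : left_id 1 C01_scale.
Proof. by move=> f; apply: C01P => p; exact: scale1r. Qed.
Lemma C01_scaleDr : right_distributive C01_scale +%R.
Proof. by move=> k f g; apply: C01P => p; exact: scalerDr. Qed.
Lemma C01_scaleDl f : {morph C01_scale^~ f : a b / a + b}.
Proof. by move=> a b; apply: C01P => p; exact: scalerDl. Qed.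

HB.instance Definition _ := GRing.Zmodule_isLmodule.Build R[i] (C01 C)
  C01_scaleA C01_scale1 C01_scaleDr C01_scaleDl.

Lemma C01_mulA f g h : C01_mul f (C01_mul g h) = C01_mul (C01_mul f g) h.
Proof. by apply: C01P => p; exact: amulA. Qed.
Lemma C01_mulDl f g h : C01_mul (f + g) h = C01_mul f h + C01_mul g h.
Proof. by apply: C01P => p; exact: amulDl. Qed.
Lemma C01_mulDr f g h : C01_mul f (g + h) = C01_mul f g + C01_mul f h.
Proof. by apply: C01P => p; exact: amulDr. Qed.
Lemma C01_mulZl (k : R[i]) f g : C01_mul (k *: f) g = k *: C01_mul f g.
Proof. by apply: C01P => p; exact: amulZl. Qed.
Lemma C01_mulZr (k : R[i]) f g : C01_mul f (k *: g) = k *: C01_mul f g.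
Proof. by apply: C01P => p; exact: amulZr. Qed.
Lemma C01_starK f : C01_star (C01_star f) = f.
Proof. by apply: C01P => p; exact: starK. Qed.
Lemma C01_starD f g : C01_star (f + g) = C01_star f + C01_star g.
Proof. by apply: C01P => p; exact: starD. Qed.
Lemma C01_starZ (k : R[i]) f : C01_star (k *: f) = Num.conj k *: C01_star f.
Proof. by apply: C01P => p; exact: starZ. Qed.
Lemma C01_starM f g :
  C01_star (C01_mul f g) = C01_mul (C01_star g) (C01_star f).
Proof. by apply: C01P => p; exact: starM. Qed.

HB.instance Definition _ := Lmodule_isStarAlgebra.Build R[i] (C01 C)
  C01_mulA C01_mulDl C01_mulDr C01_mulZl C01_mulZr
  C01_starK C01_starD C01_starZ C01_starM.

Definition C01_dist f g : R := isup (fun p => dist (f p) (g p)).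
Definition C01_snorm n f : R := isup (fun p => snorm n (f p)).

Lemma dist_cts f g : continuous (fun p => dist (f p) (g p)).
Proof.
apply: (@continuous2_comp I C C _ f g (fun x y => dist x y : R)).
- exact: C01_cts.
- exact: C01_cts.
- exact: dist_continuous.
Qed.

Lemma snorm_cts n f : continuous (fun p => snorm n (f p)).
Proof.
move=> p; apply: (@continuous_comp _ _ _ (C01_fun f) (snorm n)).
  exact: C01_cts.
exact: snorm_continuous.
Qed.

Lemma le_C01_dist f g p : dist (f p) (g p) <= C01_dist f g.
Proof.
by apply: (@le_isup R (fun p => dist (f p) (g p)) p); exact: dist_cts.
Qed.

Lemma le_C01_snorm n f p : snorm n (f p) <= C01_snorm n f.
Proof. by apply: (@le_isup R (fun p => snorm n (f p)) p); exact: snorm_cts. Qed.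

Lemma C01_distxx f : C01_dist f f = 0.
Proof.
apply/eqP; rewrite eq_le; apply/andP; split.
  by apply: isup_le => p; rewrite distxx.
by rewrite (le_trans (dist_ge0 _ _) (le_C01_dist f f (I_proj 0))).
Qed.

Lemma C01_dist_eq0 f g : C01_dist f g = 0 -> f = g.
Proof.
move=> fg0; apply: C01P => p; apply: (@dist_eq0 R); apply/eqP.
by rewrite eq_le dist_ge0 andbT -fg0 le_C01_dist.
Qed.

Lemma C01_distC f g : C01_dist f g = C01_dist g f.
Proof. by congr isup; apply/funext => p; exact: distC. Qed.

Lemma C01_dist_triangle g f h :
  C01_dist f h <= C01_dist f g + C01_dist g h.
Proof.
apply: isup_le => p; apply: (le_trans (dist_triangle (g p) _ _)).
by rewrite lerD ?le_C01_dist.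
Qed.

HB.instance Definition _ := isMetric.Build R (C01 C)
  C01_distxx C01_dist_eq0 C01_distC C01_dist_triangle.

Lemma C01_nbhs_distP f (U : set (C01 C)) : nbhs f U <->
  exists e : R, 0 < e /\ [set g | C01_dist f g < e] `<=` U.
Proof.
rewrite -nbhs_ballE; split=> [[e /= e0 eU]|[e [e0 eU]]].
  by exists e; split=> // g fg; apply: eU; rewrite ballEmdist.
by exists e => // g; rewrite ballEmdist; exact: eU.
Qed.

Lemma C01_distD f g h : C01_dist (f + h) (g + h) = C01_dist f g.
Proof. by congr isup; apply/funext => p; exact: distD. Qed.

Lemma C01_snorm_ge0 n f : 0 <= C01_snorm n f.
Proof. exact: le_trans (snorm_ge0 _ _) (le_C01_snorm n f (I_proj 0)). Qed.

Lemma C01_snormD n f g : C01_snorm n (f + g) <= C01_snorm n f + C01_snorm n g.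
Proof.
apply: isup_le => p; apply: (le_trans (snormD n (f p) (g p))).
by rewrite lerD ?le_C01_snorm.
Qed.

Lemma C01_snormZ_le n (k : R[i]) f :
  C01_snorm n (k *: f) <= complex.Re `|k| * C01_snorm n f.
Proof.
apply: isup_le => p; rewrite [C01_fun _ _]/(k *: f p) snormZr.
by rewrite ler_wpM2l ?le_C01_snorm// normc_def /= sqrtr_ge0.
Qed.

Lemma C01_snormZ n (k : R[i]) f :
  (C01_snorm n (k *: f))%:C = `|k| * (C01_snorm n f)%:C.
Proof.
rewrite normc_def -rmorphM; congr (_%:C); apply/eqP; rewrite eq_le.
have := C01_snormZ_le n k f; rewrite normc_def /= => -> /=.
have [->|k0] := eqVneq k 0.
  by rewrite /= expr0n/= addr0 sqrtr0 mul0r C01_snorm_ge0.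
have := C01_snormZ_le n k^-1 (k *: f).
rewrite scalerA mulVf// scale1r normrV ?unitfE// normc_def.
set r := Num.sqrt _.
have r0 : 0 < r.
  by rewrite -ltcR [X in _ < X](_ : _ = `|k|) ?normr_gt0// normc_def.
by rewrite -rmorphV ?unitfE ?gt_eqF//= mulrC ler_pdivlMr// mulrC.
Qed.

Lemma C01_snorm_le n f : C01_snorm n f <= C01_snorm n.+1 f.
Proof.
by apply: isup_le => p; exact: le_trans (snorm_le _ _) (le_C01_snorm _ _ _).
Qed.

Lemma C01_snorm_star n f : C01_snorm n (star f) <= C01_snorm n.+1 f.
Proof.
apply: isup_le => p.
exact: le_trans (snorm_star _ _) (le_C01_snorm _ _ _).
Qed.

Lemma C01_snormM n f g :
  C01_snorm n (amul f g) <= C01_snorm n.+1 f * C01_snorm n.+1 g.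
Proof.
apply: isup_le => p; apply: (le_trans (snormM _ _ _)).
by rewrite ler_pM ?snorm_ge0 ?le_C01_snorm.
Qed.

Lemma C01_nbhs_snormP f (U : set (C01 C)) : nbhs f U <->
  exists n (e : R), 0 < e /\ [set g | C01_snorm n (g - f) < e] `<=` U.
Proof.
rewrite C01_nbhs_distP; split=> [[e [e0 eU]]|[n [e [e0 eU]]]].
  have e20 : 0 < e / 2 by rewrite divr_gt0.
  have : nbhs (0 : C) [set b | dist 0 b < e / 2].
    by apply/nbhs_distP; exists (e / 2); split => // z.
  move=> /nbhs_snormP[n [d [d0 dU]]]; exists n, d; split => // g fg.
  apply: eU => /=; apply: (@le_lt_trans _ _ (e / 2)); last by lra.
  apply: isup_le => p; rewrite dist0; apply/ltW/dU => /=; rewrite subr0.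
  exact: le_lt_trans (le_C01_snorm n (g - f) p) fg.
have e20 : 0 < e / 2 by rewrite divr_gt0.
have : nbhs (0 : C) [set b | snorm n b < e / 2].
  by apply/nbhs_snormP; exists n, (e / 2); split => // b /=; rewrite subr0.
move=> /nbhs_distP[d [d0 dU]]; exists d; split => // g fg.
apply: eU => /=; apply: (@le_lt_trans _ _ (e / 2)); last by lra.
apply: isup_le => p; apply/ltW/dU => /=; rewrite -dist0.
exact: le_lt_trans (le_C01_dist f g p) fg.
Qed.

Lemma C01_add_continuous : continuous (fun x : C01 C * C01 C => x.1 + x.2).
Proof.
move=> [f g] U /C01_nbhs_distP[e [e0 eU]].
have e20 : 0 < e / 2 by rewrite divr_gt0.
exists ([set f' | C01_dist f f' < e / 2],
        [set g' | C01_dist g g' < e / 2]) => /=.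
  by split; apply/C01_nbhs_distP; exists (e / 2); split => // z.
move=> [f' g'] /= [ff gg]; apply: eU => /=.
have : C01_dist (f + g) (f' + g') <= C01_dist f f' + C01_dist g g'.
  apply: isup_le => p; apply: (le_trans (distDD (f p) (g p) (f' p) (g' p))).
  by rewrite lerD ?le_C01_dist.
by lra.
Qed.

Lemma ltc_Re (k : R[i]) (e : R) : `|k| < e%:C -> complex.Re `|k| < e.
Proof. by rewrite normc_def ltcR. Qed.

Lemma Re_normD (k l : R[i]) :
  complex.Re `|k + l| <= complex.Re `|k| + complex.Re `|l|.
Proof. by have := ler_normD k l; rewrite !normc_def -rmorphD lecR. Qed.

Lemma C01_scale_continuous : continuous (fun z : R[i]^o * C01 C => z.1 *: z.2).
Proof.
move=> [k f] U /C01_nbhs_snormP[n [e [e0 eU]]].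
pose K := complex.Re `|k| + 1; pose M := C01_snorm n f + 1.
have k_ge0 (l : R[i]) : 0 <= complex.Re `|l| by rewrite normc_def /= sqrtr_ge0.
have K0 : 0 < K by have := k_ge0 k; rewrite /K; lra.
have M0 : 0 < M by have := C01_snorm_ge0 n f; rewrite /M; lra.
pose d := Num.min 1 (e / 2 / M).
have d0 : 0 < d by rewrite lt_min ltr01 !divr_gt0.
exists ([set l : R[i]^o | `|k - l| < d%:C],
        [set g | C01_snorm n (g - f) < e / 2 / K]) => /=.
  split; last first.
    apply/C01_nbhs_snormP; exists n, (e / 2 / K).
    by rewrite !divr_gt0//; split => // z.
  apply: (@nbhsx_ballx _ R[i]^o k d%:C).
  by rewrite ltcR.
move=> [l g] /= [kl fg]; apply: eU => /=.
have -> : l *: g - k *: f = l *: (g - f) + (l - k) *: f.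
  by rewrite scalerBr scalerBl addrA subrK.
apply: (le_lt_trans (C01_snormD _ _ _)).
have Kl : complex.Re `|l| <= K.
  have := Re_normD k (l - k); rewrite addrC subrK => kl'.
  have := ltc_Re kl; rewrite distrC /K.
  have : d <= 1 by rewrite ge_min lexx.
  by lra.
have h1 : complex.Re `|l| * C01_snorm n (g - f) <= K * C01_snorm n (g - f).
  by rewrite ler_wpM2r ?C01_snorm_ge0.
have h2 : K * C01_snorm n (g - f) < e / 2 by rewrite mulrC -ltr_pdivlMr.
have h3 : complex.Re `|l - k| * C01_snorm n f <= e / 2.
  apply: (@le_trans _ _ (d * M)).
    rewrite ler_pM ?C01_snorm_ge0//; last by rewrite /M; lra.
    by apply/ltW/ltc_Re; rewrite distrC.
  by rewrite -ler_pdivlMr// ge_min lexx orbT.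
have := C01_snormZ_le n l (g - f); have := C01_snormZ_le n (l - k) f.
lra.
Qed.

Lemma C01_ball_open n f (e : R) : open [set g | C01_snorm n (g - f) < e].
Proof.
rewrite openE => g /= ge.
apply/C01_nbhs_snormP; exists n, (e - C01_snorm n (g - f)).
split; first by rewrite subr_gt0.
move=> h /= hg; have := C01_snormD n (h - g) (g - f).
by rewrite addrA subrK; lra.
Qed.

Lemma C01_locally_convex : exists2 B : set_system (C01 C),
  (forall b, b \in B -> convex_set b) & basis B.
Proof.
exists [set b | exists n f (e : R), b = [set g | C01_snorm n (g - f) < e]].
  move=> B /set_mem[n [f [e ->]]] g h k /set_mem /= ge /set_mem /= he.
  apply/mem_set => /=.
  rewrite [X in C01_snorm n (X - f)](_ : _ =
    k%:num *: (g : C01 C) + (1 - k%:num) *: (h : C01 C)); last by [].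
  have -> : k%:num *: (g : C01 C) + (1 - k%:num) *: (h : C01 C) - f =
      k%:num *: (g - f) + (1 - k%:num) *: (h - f).
    rewrite !scalerBr addrACA -opprD -scalerDl.
    by rewrite [k%:num + _]addrC subrK scale1r.
  have ab1 : complex.Re `|k%:num| + complex.Re `|1 - k%:num| = 1.
    by rewrite !ger0_norm ?subr_ge0// -raddfD [k%:num + _]addrC subrK.
  have a0 : 0 <= complex.Re `|k%:num| by rewrite normc_def /= sqrtr_ge0.
  have b0 : 0 <= complex.Re `|1 - k%:num| by rewrite normc_def /= sqrtr_ge0.
  apply: (le_lt_trans (C01_snormD _ _ _)).
  have := C01_snormZ_le n k%:num (g - f).
  have := C01_snormZ_le n (1 - k%:num) (h - f).
  move: ge he a0 b0 ab1.
  move: (C01_snorm n (g - f)) (C01_snorm n (h - f)) => s t.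
  move: (complex.Re `|k%:num|) (complex.Re `|1 - k%:num|) => a b.
  move=> se te a0 b0 ab1 hb ha; apply: (le_lt_trans (lerD ha hb)).
  pose m := Num.max s t.
  have me : m < e by rewrite gt_max se te.
  apply: (le_lt_trans _ me).
  have : a * s <= a * m by rewrite ler_wpM2l// le_max lexx.
  have : b * t <= b * m by rewrite ler_wpM2l// le_max lexx orbT.
  have : a * m + b * m = m by rewrite -mulrDl ab1 mul1r.
  by lra.
split; first by move=> b [n [f [e ->]]]; exact: C01_ball_open.
move=> f U /C01_nbhs_snormP[n [e [e0 eU]]].
exists [set g | C01_snorm n (g - f) < e] => //; split; first by exists n, f, e.
rewrite /= subrr; apply: le_lt_trans e0.
by apply: isup_le => p; rewrite [C01_fun _ _](_ : _ = 0)// snorm0.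
Qed.

HB.instance Definition _ :=
  PreTopologicalNmodule_isTopologicalNmodule.Build (C01 C) C01_add_continuous.
HB.instance Definition _ :=
  TopologicalNmodule_isTopologicalLmodule.Build R[i] (C01 C)
    C01_scale_continuous.
HB.instance Definition _ :=
  Uniform_isTvs.Build R[i] (C01 C) C01_locally_convex.

Lemma C01_amul_continuous :
  continuous (fun x : C01 C * C01 C => amul x.1 x.2).
Proof.
move=> [f g] U /C01_nbhs_snormP[n [e [e0 eU]]].
pose M := Num.max (C01_snorm n.+1 f) (C01_snorm n.+1 g) + 1.
have fM : C01_snorm n.+1 f <= M - 1 by rewrite addrK le_max lexx.
have gM : C01_snorm n.+1 g <= M - 1 by rewrite addrK le_max lexx orbT.
have M1 : 1 <= M by have := C01_snorm_ge0 n.+1 f; lra.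
pose d := Num.min 1 (e / 2 / M).
have d0 : 0 < d by rewrite lt_min ltr01 !divr_gt0// (lt_le_trans ltr01).
have d1 : d <= 1 by rewrite ge_min lexx.
have dM : d * M <= e / 2.
  by rewrite -ler_pdivlMr ?ge_min ?lexx ?orbT// (lt_le_trans ltr01).
exists ([set f' | C01_snorm n.+1 (f' - f) < d],
        [set g' | C01_snorm n.+1 (g' - g) < d]) => /=.
  by split; apply/C01_nbhs_snormP; exists n.+1, d; split => // z.
move=> [f' g'] /= [ff gg]; apply: eU => /=.
have -> : amul f' g' - amul f g = amul (f' - f) g' + amul f (g' - g).
  by rewrite amulDl amulDr amulNl amulNr addrA subrK.
apply: (le_lt_trans (C01_snormD _ _ _)).
have g'M : C01_snorm n.+1 g' <= M.
  by have := C01_snormD n.+1 (g' - g) g; rewrite subrK; lra.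
have h1 : C01_snorm n (amul (f' - f) g') <= d * M.
  by apply: (le_trans (C01_snormM _ _ _)); rewrite ler_pM ?C01_snorm_ge0// ltW.
have h2 : C01_snorm n (amul f (g' - g)) < M * d.
  apply: (le_lt_trans (C01_snormM _ _ _)).
  have [p0|p0] := ltP 0 (C01_snorm n.+1 f).
    apply: (@lt_le_trans _ _ (C01_snorm n.+1 f * d)); first by rewrite ltr_pM2l.
    by rewrite ler_wpM2r//; [exact: ltW|lra].
  have -> : C01_snorm n.+1 f = 0 by apply/eqP; rewrite eq_le p0 C01_snorm_ge0.
  by rewrite mul0r mulr_gt0// (lt_le_trans ltr01).
by move: h2; rewrite mulrC => h2; lra.
Qed.

Lemma C01_star_continuous : continuous (star : C01 C -> C01 C).
Proof.
move=> f U /C01_nbhs_snormP[n [e [e0 eU]]].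
apply/C01_nbhs_snormP; exists n.+1, e; split => // g /= fg; apply: eU => /=.
have -> : star g - star f = star (g - f).
  by rewrite starD starN.
exact: le_lt_trans (C01_snorm_star _ _) fg.
Qed.

HB.instance Definition _ := Tvs_isMetrisedStarAlgebra.Build R (C01 C)
  C01_snorm_ge0 C01_snormD C01_snormZ C01_snorm_le C01_snorm_star C01_snormM
  C01_nbhs_snormP C01_distxx C01_dist_eq0 C01_distC C01_dist_triangle C01_distD
  C01_nbhs_distP C01_amul_continuous C01_star_continuous.

End C01_algebra.

Section unitaries.
Context (R : realType) (A : mlcStarAlgType R).
Implicit Types a b : A.

Definition bullet a b : A := a + b + amul a b.

Definition bullet_inv a : Prop := exists a', bullet a a' = 0 /\ bullet a' a = 0.

Definition unitaries : set A :=
  [set u | bullet u (star u) = 0 /\ bullet (star u) u = 0].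

Definition selfadjoint : set A := [set b | star b = b].

(* Only the values of `isr_fun` on `isr_dom` are relevant. `convex_set` uses  *)
(* the scalars of R[i] between 0 and 1, which are the real ones.              *)
Record inverse_sqrt := InverseSqrt {
  isr_dom : set A ;
  isr_fun : A -> A ;
  isr_dom_sa : isr_dom `<=` selfadjoint ;
  isr_dom_convex : convex_set isr_dom ;
  isr_dom_open : exists2 O : set A, open O & isr_dom = O `&` selfadjoint ;
  isr_dom0 : isr_dom 0 ;
  isr_fun_continuous : {within isr_dom, continuous isr_fun} ;
  isr_fun_sa : forall b, isr_dom b -> selfadjoint (isr_fun b) ;
  isr_fun_comm : forall b, isr_dom b ->
    bullet b (isr_fun b) = bullet (isr_fun b) b ;
  isr_funP : forall b, isr_dom b ->
    bullet b (bullet (isr_fun b) (isr_fun b)) = 0 ;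
  isr_dom_inv : forall b, isr_dom b -> bullet_inv b ;
  isr_fun0 : isr_fun 0 = 0
}.

End unitaries.

Arguments unitaries {R} A.
Arguments selfadjoint {R} A.

Definition unitary_group (R : realType) (A : mlcStarAlgType R) :
    topologicalType :=
  set_type (unitaries A).

Section homotopy_classes.
Context (R : realType).

Definition homotopic (X Y : topologicalType) (w0 w1 : X -> Y) : Prop :=
  exists H : X * R -> Y, {within [set: X] `*` `[0, 1], continuous H} /\
    forall x, H (x, 0) = w0 x /\ H (x, 1) = w1 x.

Definition homotopy_class (X Y : topologicalType) (w : continuousType X Y) :
    set (continuousType X Y) :=
  [set w' | homotopic w w'].

(* The set [X, Y]. *)
Definition homotopy_classes (X Y : topologicalType) :
    set (set (continuousType X Y)) :=
  range (@homotopy_class X Y).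

Definition comp_class (X Y Z : topologicalType)
    (c2 : set (continuousType Y Z)) (c1 : set (continuousType X Y)) :
    set (continuousType X Z) :=
  [set w | exists w2 w1, [/\ c2 w2, c1 w1 & homotopic (w2 \o w1) w]].

End homotopy_classes.

Arguments homotopy_classes R X Y : clear implicits.

Section pbam.
Context (R : realType).

(* Families `f : R -> A -> B` stand for maps A x [0, +oo[ -> B: only their    *)
(* values at nonnegative times are relevant. Separability of A and B plays no *)
(* role here, so that B can be `C01 C`.                                       *)
Record pbam (A B : mlcStarAlgType R) (f : R -> A -> B) : Prop := {
  pbam_continuous :
    {within [set x : A * R | 0 <= x.2], continuous (fun x => f x.2 x.1)} ;
  pbam_bounded : forall (a : A) n,
    exists M, forall t, 0 <= t -> snorm n (f t a) <= M ;
  pbam_sac : forall (e : R) (a : A), 0 < e ->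
    exists eta P : R, [/\ 0 < eta, 0 <= P &
      forall (a' : A) t, dist a a' < eta -> P <= t ->
        dist (f t a) (f t a') < e] ;
  pbam_star : forall a : A,
    star (f t a) - f t (star a) @[t --> +oo] --> (0 : B) ;
  pbam_scale : forall (k : R[i]) (a : A),
    k *: f t a - f t (k *: a) @[t --> +oo] --> (0 : B) ;
  pbam_add : forall a a' : A,
    f t a + f t a' - f t (a + a') @[t --> +oo] --> (0 : B) ;
  pbam_mul : forall a a' : A,
    amul (f t a) (f t a') - f t (amul a a') @[t --> +oo] --> (0 : B)
}.

(* `induced_class` is U(f): the maps homotopic to some `ftilde alpha`. As the *)
(* class does not depend on alpha, this is a single homotopy class.         *)
Section induced_class.
Context (A B : mlcStarAlgType R) (isr : inverse_sqrt B) (f : R -> A -> B).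

Definition admissible (alpha : unitary_group A -> R) : Prop :=
  [/\ continuous alpha, forall v, 0 <= alpha v &
    forall v t, alpha v <= t ->
      isr_dom isr (bullet (f t (val v)) (star (f t (val v)))) /\
      isr_dom isr (bullet (star (f t (val v))) (f t (val v)))].

Definition ftilde (alpha : unitary_group A -> R) (v : unitary_group A) : B :=
  let b := f (alpha v) (val v) in bullet b (isr_fun isr (bullet (star b) b)).

Definition induced_class :
    set (continuousType (unitary_group A) (unitary_group B)) :=
  [set w | exists alpha
      (u : continuousType (unitary_group A) (unitary_group B)),
    [/\ admissible alpha, forall v, val (u v) = ftilde alpha v &
        homotopic R u w]].

End induced_class.

Definition pba_homotopy (A C : mlcStarAlgType R) (h : R -> A -> C01 C)
    (k l : R -> A -> C) : Prop :=
  pbam h /\ forall t a, 0 <= t ->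
    h t a (I_proj 0) = k t a /\ h t a (I_proj 1) = l t a.

Definition pbam_comp (A B C : mlcStarAlgType R) (g : R -> B -> C) (phi : R -> R)
    (f : R -> A -> B) : R -> A -> C :=
  fun t a => g (phi t) (f t a).

Definition reparameterisation (phi : R -> R) : Prop :=
  [/\ {within `[0, +oo[, continuous phi},
    forall t, 0 <= t -> 0 <= phi t &
    forall s t, 0 <= s -> s <= t -> phi s <= phi t].

Definition valid_reparameterisation (A B C : mlcStarAlgType R)
    (f : R -> A -> B) (g : R -> B -> C) (phi : R -> R) : Prop :=
  [/\ reparameterisation phi, pbam (pbam_comp g phi f) &
    forall theta, reparameterisation theta ->
      (forall t, 0 <= t -> phi t <= theta t) ->
      pbam (pbam_comp g theta f) /\
      exists h : R -> A -> C01 C,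
        pba_homotopy h (pbam_comp g theta f) (pbam_comp g phi f) /\
        forall t a (p : unit_itv R), 0 <= t ->
          h t a p = g (val p * phi t + (1 - val p) * theta t) (f t a)].

Definition condition_C1 (A B C : mlcStarAlgType R)
    (f : R -> A -> B) (g : R -> B -> C) : Prop :=
  forall (a : A) (nu : R), 0 < nu ->
    exists xi Q : R, [/\ 0 < xi, 0 <= Q &
      forall t, Q <= t -> exists S, 0 <= S /\
        forall (b : B) s, S <= s ->
          dist (f t a) b < xi -> dist (g s (f t a)) (g s b) < nu].

Definition condition_C3 (A B C : mlcStarAlgType R)
    (f : R -> A -> B) (g : R -> B -> C) : Prop :=
  forall (a : A) n,
    exists Q M : R, [/\ 0 <= Q, 0 <= M &
      forall t, Q <= t -> exists S, 0 <= S /\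
        forall s, S <= s -> snorm n (g s (f t a)) <= M].

End pbam.

(* Main.v *)
Require Import Defs.
From mathcomp Require Import all_boot all_order all_algebra.
From mathcomp Require Import all_classical all_reals all_analysis.
From mathcomp Require Import complex ring lra.

Set Implicit Arguments.
Unset Strict Implicit.
Unset Printing Implicit Defensive.

Import Order.TTheory GRing.Theory Num.Theory.
Import numFieldTopology.Exports numFieldNormedType.Exports.

Local Open Scope classical_set_scope.
Local Open Scope ring_scope.
Local Open Scope complex_scope.

(** In the unitisation, [a • b] is the product of [1 + a] and [1 + b], and the
    map [polar] below sends an almost unitary element to its unitary part.  The
    class induced by an asymptotic morphism [f] is that of
    [v |-> polar (f_{alpha v} v)], for [alpha v] so large that [f_t v] is almost
    unitary from time [alpha v] on.

    The composite of the classes of [g] and [f] is thus represented by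
    [polar (g_{beta u} u)] with [u = polar (f_{alpha v} v)], and the class of
    the composed morphism by [polar (g_{phi (alpha v)} b)] with
    [b = f_{alpha v} v].  They are joined in three steps, with [s v] a
    continuous time that exceeds both [beta u] and [phi (alpha v)]:
    - move the time of [g] from [phi (alpha v)] to [s v] at the point [b];
    - follow the segment from [g_{s v} b] to [g_{s v} u];
    - move the time of [g] back from [s v] to [beta u] at the point [u].
    Taking polar parts turns these into homotopies of unitaries, as long as
    everything stays almost unitary ([homotopic_polar], [homotopic_time]).

    The third step is harmless because [u] is unitary and [beta] admissible.
    The second works since [u] is close to [b] for [alpha v] large
    ([near_polar]): by [condition_C1] the two ends of the segment are then close
    for late [s v], and by [condition_C3] they stay in a bounded set, on which
    closeness in the additive sense is closeness of the products [z • z^*]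
    ([bullet_star_uniform], [near_segment_stable]).  The first step needs
    [g_r (f_t v)] to be almost unitary for all [r >= phi t] at once, although
    the validity of [phi] speaks of one reparameterisation [theta] at a time;
    [comp_near_unitary] gets it by choosing a [theta] above a sequence of
    hypothetical bad times.

    The conditions on [alpha], [beta] and [s] hold from some time on, locally
    uniformly in the unitary, but the group of unitaries is not compact.  The
    required continuous functions come from [threshold], the inverse of a
    Lipschitz function. *)

(** * Continuity and homotopy *)

Section continuity.

(** Restricting the domain of [k] to the subtype [D] turns continuity within
    [D] into plain continuity, for which composition is available. *)
Lemma continuous_within_comp (X Y Z : topologicalType) (D : set Y)
    (k : Y -> Z) (l : X -> Y) : {within D, continuous k} -> continuous l ->
  (forall x, D (l x)) -> continuous (k \o l).
Proof.
move=> /subspace_sigL_continuousP ck cl Dl.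
pose l' x : set_type D := exist _ (l x) (mem_set (Dl x)).
have cl' : continuous l' by apply: continuous_comp_initial; exact: cl.
move=> x; apply: (@continuous_comp _ _ _ l' (sigL D k)); first exact: cl'.
exact: ck.
Qed.

Lemma continuous_pair (X Y Z : topologicalType) (k : X -> Y) (l : X -> Z) :
  continuous k -> continuous l -> continuous (fun x => (k x, l x)).
Proof. by move=> ck cl x; apply: cvg_pair; [exact: ck|exact: cl]. Qed.

Lemma fst_continuous (X Y : topologicalType) : continuous (@fst X Y).
Proof. by move=> xy; exact: cvg_fst. Qed.

Lemma snd_continuous (X Y : topologicalType) : continuous (@snd X Y).
Proof. by move=> xy; exact: cvg_snd. Qed.

Lemma continuous_compose (X Y Z : topologicalType) (l : Y -> Z) (k : X -> Y) :
  continuous l -> continuous k -> continuous (fun x => l (k x)).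
Proof. by move=> cl ck x; apply: continuous_comp; [exact: ck|exact: cl]. Qed.

Variable R : realType.

Lemma continuous_addR (X : topologicalType) (k l : X -> R) :
  continuous k -> continuous l -> continuous (fun x => k x + l x).
Proof. by move=> ck cl x; apply: cvgD; [exact: ck|exact: cl]. Qed.

Lemma continuous_mulR (X : topologicalType) (k l : X -> R) :
  continuous k -> continuous l -> continuous (fun x => k x * l x).
Proof. by move=> ck cl x; apply: cvgM; [exact: ck|exact: cl]. Qed.

Lemma I_clamp_continuous : continuous (@I_clamp R).
Proof.
move=> x; apply: (@continuous_max R R^o (cst 0) (Num.min ^~ 1) x).
  exact: cvg_cst.
by apply: (@continuous_min R R^o id (cst 1) x); [exact: cvg_id|exact: cvg_cst].
Qed.

Lemma I_clamp_in (x : R) : 0 <= I_clamp x <= 1.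
Proof. by have := I_clampP x; rewrite inE /= in_itv. Qed.

Lemma I_clamp_id (x : R) : 0 <= x <= 1 -> I_clamp x = x.
Proof. by case/andP=> x0 x1; rewrite /I_clamp min_l// max_r. Qed.

End continuity.

Section homotopy_relation.
Context (R : realType).
Implicit Types X Y Z : topologicalType.

(** Clamping the time extends a homotopy to all times, so that it can be
    composed and reparameterised without side conditions on subspaces. *)
Lemma homotopicP X Y (w0 w1 : X -> Y) : homotopic R w0 w1 <->
  exists H : X * R -> Y, continuous H /\
    forall x, H (x, 0) = w0 x /\ H (x, 1) = w1 x.
Proof.
split=> [[H [cH H01]]|[H [cH H01]]]; last first.
  by exists H; split => //; exact: continuous_subspaceT.
exists (H \o (fun z => (z.1, I_clamp z.2))); split.
  apply: (continuous_within_comp cH).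
    apply: continuous_pair; first exact: fst_continuous.
    exact: continuous_compose (@I_clamp_continuous R) (@snd_continuous _ _).
  by move=> z; split => //=; rewrite in_itv /= I_clamp_in.
by move=> x /=; rewrite !I_clamp_id ?lexx ?ler01.
Qed.

Lemma homotopic_refl X Y (w : X -> Y) : continuous w -> homotopic R w w.
Proof.
move=> cw; apply/homotopicP; exists (fun z => w z.1); split => //.
exact: continuous_compose cw (@fst_continuous _ _).
Qed.

Lemma homotopic_sym X Y (w0 w1 : X -> Y) :
  homotopic R w0 w1 -> homotopic R w1 w0.
Proof.
move=> /homotopicP[H [cH H01]]; apply/homotopicP.
exists (H \o (fun z => (z.1, 1 - z.2))); split; last first.
  by move=> x /=; rewrite subr0 subrr; case: (H01 x).
move=> z; apply: continuous_comp; last exact: cH.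
move: z; apply: continuous_pair; first exact: fst_continuous.
move=> z; apply: cvgB; first exact: cvg_cst.
exact: cvg_snd.
Qed.

Lemma homotopic_trans X Y (w0 w1 w2 : X -> Y) :
  homotopic R w0 w1 -> homotopic R w1 w2 -> homotopic R w0 w2.
Proof.
move=> /homotopicP[H [cH H01]] /homotopicP[K [cK K01]].
pose L (z : X * R) := if z.2 <= 2^-1 then H (z.1, 2 * z.2)
                      else K (z.1, 2 * z.2 - 1).
have closed_le : closed [set z : X * R | z.2 <= 2^-1].
  apply: (@preimage_closed _ _ snd [set y : R | y <= 2^-1]).
    by move=> z _; exact: snd_continuous.
  exact: closed_le.
have closed_ge : closed [set z : X * R | 2^-1 <= z.2].
  apply: (@preimage_closed _ _ snd [set y : R | 2^-1 <= y]).
    by move=> z _; exact: snd_continuous.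
  exact: closed_ge.
have c2 : continuous (fun z : X * R => 2 * z.2).
  apply: continuous_mulR; first by move=> z; exact: cvg_cst.
  by move=> z; exact: cvg_snd.
have cLle : {within [set z : X * R | z.2 <= 2^-1], continuous L}.
  apply: (@subspace_eq_continuous _ _ _ (H \o (fun z => (z.1, 2 * z.2)))).
    by move=> z; rewrite inE /= /L /from_subspace => ->.
  apply: continuous_subspaceT => z; apply: continuous_comp; last exact: cH.
  by move: z; apply: continuous_pair c2; exact: fst_continuous.
have cLge : {within [set z : X * R | 2^-1 <= z.2], continuous L}.
  apply: (@subspace_eq_continuous _ _ _ (K \o (fun z => (z.1, 2 * z.2 - 1)))).
    move=> z; rewrite inE /= /L /from_subspace => z2.
    case: ifPn => // z2'.
    have -> : z.2 = 2^-1 by apply/le_anti; rewrite z2 z2'.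
    by rewrite mulfV ?pnatr_eq0// subrr; case: (H01 z.1) (K01 z.1) => _ -> [->].
  apply: continuous_subspaceT => z; apply: continuous_comp; last exact: cK.
  move: z; apply: continuous_pair; first exact: fst_continuous.
  by apply: continuous_addR c2 _ => z; exact: cvg_cst.
apply/homotopicP; exists L; split.
  have := withinU_continuous closed_le closed_ge cLle cLge.
  rewrite (_ : _ `|` _ = setT); first by
    move=> cL; apply/continuous_subspace_setT.
  by apply/seteqP; split=> // z _ /=; apply/orP; exact: le_total.
move=> x; rewrite /L /= mulr0 mulr1 invr_ge0 ler0n.
have /negbTE -> : ~~ (1 <= 2^-1 :> R) by rewrite -ltNge invf_lt1 ?ltr1n.
rewrite (_ : 2 - 1 = 1 :> R); last by rewrite -(natrB _ (isT : (1 <= 2)%N)).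
by case: (H01 x) (K01 x) => -> _ [_ ->].
Qed.

Lemma homotopic_comp X Y Z (w0 w1 : X -> Y) (w2 w3 : Y -> Z) :
  homotopic R w0 w1 -> homotopic R w2 w3 ->
  homotopic R (w2 \o w0) (w3 \o w1).
Proof.
move=> /homotopicP[H [cH H01]] /homotopicP[K [cK K01]]; apply/homotopicP.
exists (K \o (fun z => (H z, z.2))); split; last first.
  move=> x /=; case: (H01 x) => -> ->.
  by case: (K01 (w0 x)) (K01 (w1 x)) => -> _ [_ ->].
move=> z; apply: continuous_comp; last exact: cK.
by move: z; apply: continuous_pair cH _ => z; exact: cvg_snd.
Qed.

End homotopy_relation.

(** * Unitary parts of almost unitary elements *)

Section bullet_algebra.
Context (R : realType) (A : mlcStarAlgType R).
Implicit Types a b c u z : A.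

Lemma bulletA a b c : bullet a (bullet b c) = bullet (bullet a b) c.
Proof.
rewrite /bullet !amulDl !amulDr amulA.
by rewrite [LHS](AC (1*3*3) ((1*2*5)*3*(6*4*7))).
Qed.

Lemma amul0l a : amul 0 a = 0.
Proof. by rewrite -(scale0r (0 : A)) amulZl !scale0r. Qed.

Lemma amul0r a : amul a 0 = 0.
Proof. by rewrite -(scale0r (0 : A)) amulZr !scale0r. Qed.

Lemma bullet0l a : bullet 0 a = a.
Proof. by rewrite /bullet amul0l add0r addr0. Qed.

Lemma bullet0r a : bullet a 0 = a.
Proof. by rewrite /bullet amul0r !addr0. Qed.

Lemma star_bullet a b : star (bullet a b) = bullet (star b) (star a).
Proof. by rewrite /bullet !starD starM [star a + _]addrC. Qed.

Lemma bullet_starr_sa z : selfadjoint A (bullet z (star z)).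
Proof. by rewrite /selfadjoint /= star_bullet starK. Qed.

Lemma bullet_starl_sa z : selfadjoint A (bullet (star z) z).
Proof. by rewrite /selfadjoint /= star_bullet starK. Qed.

Lemma bullet_continuous (X : topologicalType) (k l : X -> A) :
  continuous k -> continuous l -> continuous (fun x => bullet (k x) (l x)).
Proof.
move=> ck cl; apply: (@continuous2_comp X A A A _ _ (fun a b => a + b)).
- apply: (@continuous2_comp X A A A _ _ (fun a b => a + b)) => //.
  exact: tvs.add_continuous.
- apply: (@continuous2_comp X A A A _ _ (fun a b => amul a b)) => //.
  exact: amul_continuous.
- exact: tvs.add_continuous.
Qed.

End bullet_algebra.

Section perturbation.
Context (R : realType) (A : mlcStarAlgType R).
Implicit Types z : A.

Lemma snorm_star_bullet_diff n z z' (M d : R) : d <= 1 ->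
  snorm n.+2 z <= M -> snorm n.+2 (z' - z) <= d ->
  snorm n (bullet z' (star z') - bullet z (star z)) <= (2 * M + 3) * d.
Proof.
move=> d1 zM; have -> : z' = z + (z' - z) by rewrite addrC subrK.
move: (z' - z) => x; rewrite addrAC subrr add0r => zd.
have -> : bullet (z + x) (star (z + x)) - bullet z (star z) =
    x + star x + amul z (star x) + amul x (star z) + amul x (star x).
  rewrite /bullet starD !amulDl !amulDr.
  rewrite [LHS](AC ((2*2*(2*2))*1) ((2*4*6*7*8)*((1*3*5)*9))).
  by rewrite /= subrr addr0.
have ge0 m (y : A) : 0 <= snorm m y by exact: snorm_ge0.
have x1 : snorm n.+1 x <= d by exact: le_trans (snorm_le _ _) zd.
have x0 : snorm n x <= d by exact: le_trans (snorm_le _ _) x1.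
have xs0 : snorm n (star x) <= d by exact: le_trans (snorm_star _ _) x1.
have xs1 : snorm n.+1 (star x) <= d by exact: le_trans (snorm_star _ _) zd.
have z1 : snorm n.+1 z <= M by exact: le_trans (snorm_le _ _) zM.
have zs1 : snorm n.+1 (star z) <= M by exact: le_trans (snorm_star _ _) zM.
have m1 : snorm n (amul z (star x)) <= M * d.
  by apply: le_trans (snormM _ _ _) _; rewrite ler_pM.
have m2 : snorm n (amul x (star z)) <= M * d.
  by apply: le_trans (snormM _ _ _) _; rewrite (mulrC M) ler_pM.
have m3 : snorm n (amul x (star x)) <= 1 * d.
  by apply: le_trans (snormM _ _ _) _; rewrite ler_pM// (le_trans x1).
have := snormD n (x + star x + amul z (star x) + amul x (star z))
  (amul x (star x)).
have := snormD n (x + star x + amul z (star x)) (amul x (star z)).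
have := snormD n (x + star x) (amul z (star x)).
have := snormD n x (star x).
by lra.
Qed.

(** On a bounded set, [z |-> z • z^*] and [z |-> z^* • z] are uniformly
    continuous.  Without the bound the cross terms of the product would not be
    controlled, which is why boundedness of the morphisms matters. *)
Lemma bullet_star_uniform n (M e : R) : 0 < e -> exists d, 0 < d /\
  forall z z', snorm n.+3 z <= M -> snorm n.+3 (z' - z) <= d ->
    snorm n (bullet z' (star z') - bullet z (star z)) < e /\
    snorm n (bullet (star z') z' - bullet (star z) z) < e.
Proof.
move=> e0; pose M' := Num.max 0 M.
have M'0 : 0 <= M' by rewrite le_max lexx.
have K0 : 0 < 2 * M' + 4 by lra.
pose d := Num.min 1 (e / (2 * M' + 4)).
have d0 : 0 < d by rewrite lt_min ltr01 divr_gt0.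
have d1 : d <= 1 by rewrite ge_min lexx.
have de : (2 * M' + 3) * d < e.
  apply: (@lt_le_trans _ _ ((2 * M' + 4) * d)).
    by rewrite ltr_pM2r//; lra.
  by rewrite mulrC -ler_pdivlMr// ge_min lexx orbT.
exists d; split => // z z' zM zd.
have zM' : snorm n.+3 z <= M' by rewrite (le_trans zM)// le_max lexx orbT.
split; apply: le_lt_trans de.
  by apply: snorm_star_bullet_diff => //; exact: le_trans (snorm_le _ _) _.
(* [z^* • z] is the first case at [z^*], at the cost of one more seminorm. *)
rewrite -{2}(starK z') -{2}(starK z); apply: snorm_star_bullet_diff => //.
  exact: le_trans (snorm_star _ _) _.
by rewrite -starN -starD; exact: le_trans (snorm_star _ _) _.
Qed.

End perturbation.

Section polar.
Context (R : realType) (A : mlcStarAlgType R) (isr : inverse_sqrt A).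
Implicit Types u z : A.

Definition polar_dom : set A :=
  [set z | isr_dom isr (bullet z (star z)) /\ isr_dom isr (bullet (star z) z)].

(** In the unitisation, [1 + polar z] is the unitary part
    [(1 + z) |1 + z|^-1] of the polar decomposition of [1 + z]. *)
Definition polar z : A := bullet z (isr_fun isr (bullet (star z) z)).

(** With [b = z^* • z] and [w] its inverse square root, [w • b • w = 0] since
    [w] commutes with [b].  For the product in the other order, [z] is
    invertible on both sides because [z^* • z] and [z • z^*] are, so that the
    left inverse [w • w • z^*] of [z] is also a right inverse. *)
Lemma polar_unitary z : polar_dom z -> unitaries A (polar z).
Proof.
move=> [zs sz]; rewrite /unitaries /= /polar.
set b := bullet (star z) z; set w := isr_fun isr b.
have wsa : star w = w by exact: isr_fun_sa.
have bw : bullet b w = bullet w b by exact: isr_fun_comm.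
have bww : bullet b (bullet w w) = 0 by exact: isr_funP.
have wwb : bullet (bullet w w) b = 0.
  by rewrite -bulletA -bw bulletA -bw -bulletA.
rewrite star_bullet wsa; split; last first.
  by rewrite -bulletA [bullet (star z) _]bulletA -/b bulletA -bw -bulletA.
have [c [zc _]] := isr_dom_inv zs; rewrite -bulletA in zc.
pose l := bullet (bullet w w) (star z).
have lz : bullet l z = 0 by rewrite /l -bulletA -/b.
have l_c : l = bullet (star z) c.
  by rewrite -[l]bullet0r -zc bulletA lz bullet0l.
by rewrite -bulletA [bullet w (bullet w _)]bulletA -/l l_c.
Qed.

Lemma polar_continuous : {within polar_dom, continuous polar}.
Proof.
apply/subspace_sigL_continuousP; rewrite /sigL /polar.
have cv : continuous (fun z : set_type polar_dom => set_val z : A).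
  exact: initial_continuous.
have cs := continuous_compose (@star_continuous R A) cv.
apply: bullet_continuous => //.
apply: (continuous_within_comp (@isr_fun_continuous _ _ isr)
  (bullet_continuous cs cv)).
by move=> z; have [] := set_mem (valP z).
Qed.

Lemma polar_domP : exists n (e : R), 0 < e /\ forall z,
  snorm n (bullet z (star z)) < e -> snorm n (bullet (star z) z) < e ->
  polar_dom z.
Proof.
have [U Uo domE] := @isr_dom_open _ _ isr.
have U0 : U 0 by have := isr_dom0 isr; rewrite domE => -[].
have /nbhs_snormP[n [e [e0 eU]]] := open_nbhs_nbhs (conj Uo U0).
exists n, e; split=> // z z1 z2; rewrite /polar_dom domE /=.
split; (split; last by [exact: bullet_starr_sa|exact: bullet_starl_sa]).
  by apply: eU; rewrite /= subr0.
by apply: eU; rewrite /= subr0.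
Qed.

(** The polar part of a bounded, almost unitary element is close to it, since
    the inverse square root is continuous at [0] and vanishes there. *)
Lemma polar_near m (M e : R) : 0 < e -> exists n d, 0 < d /\ forall z,
  polar_dom z -> snorm m.+1 z <= M -> snorm n (bullet (star z) z) < d ->
  snorm m (polar z - z) < e.
Proof.
move=> e0; pose M' := Num.max 0 M.
have M'0 : 0 <= M' by rewrite le_max lexx.
pose d' := e / (M' + 2).
have d'0 : 0 < d' by rewrite divr_gt0//; lra.
have cw : isr_fun isr @ within (isr_dom isr) (nbhs (0 : A)) --> (0 : A).
  rewrite -{2}(isr_fun0 isr).
  move/subspace_continuousP: (@isr_fun_continuous _ _ isr); apply.
  exact: isr_dom0.
have Wd : nbhs (0 : A) [set w | snorm m.+1 w < d'].
  by apply/nbhs_snormP; exists m.+1, d'; split => // w /=; rewrite subr0.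
have : nbhs (0 : A)
    [set b | isr_dom isr b -> snorm m.+1 (isr_fun isr b) < d'] by exact: cw Wd.
move=> /nbhs_snormP[n [d [d0 dw]]].
exists n, d; split => // z [_ bz] zM zd; rewrite /polar.
set b := bullet (star z) z in bz zd *.
have : snorm m.+1 (isr_fun isr b) < d' by apply: dw => //=; rewrite subr0.
move: (isr_fun isr b) => w wd.
have -> : bullet z w - z = w + amul z w.
  by rewrite /bullet -(addrA z) [z + _]addrC addrK.
apply: le_lt_trans (snormD _ _ _) _.
have h1 : snorm m w < d' by exact: le_lt_trans (snorm_le _ _) wd.
have h2 : snorm m (amul z w) <= M' * d'.
  apply: le_trans (snormM _ _ _) _; rewrite ler_pM ?snorm_ge0//.
    by rewrite (le_trans zM)// le_max lexx orbT.
  exact: ltW.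
have : (M' + 2) * d' = e by rewrite mulrC divfK// gt_eqF//; lra.
by lra.
Qed.

End polar.

(** * Continuous thresholds *)

Definition metrises (R : realType) (X : topologicalType) (d : X -> X -> R) :=
  [/\ forall x y, d x y = d y x, forall y x z, d x z <= d x y + d y z &
      forall x (U : set X), nbhs x U <->
        exists e : R, 0 < e /\ [set y | d x y < e] `<=` U].

Lemma metrises_real (R : realType) : metrises (fun x y : R => `|x - y|).
Proof.
split=> [x y|y x z|x U]; first exact: distrC.
  exact: ler_distD.
by rewrite -nbhs_ballE; split=> [[e /= e0 eU]|[e [e0 eU]]]; exists e.
Qed.

Lemma metrises_unitary_group (R : realType) (A : mlcStarAlgType R) :
  metrises (fun u v : unitary_group A => dist (val u) (val v) : R).
Proof.
split=> [u v|w u v|u U]; [exact: distC|exact: dist_triangle|split].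
  case=> _ [[/= W Wo <-] Wu WU].
  have /nbhs_distP[e [e0 eW]] := open_nbhs_nbhs (conj Wo Wu).
  by exists e; split => // v uv; apply: WU; exact: eW.
move=> [e [e0 eU]].
apply: (filterS eU).
have cv : continuous (val : unitary_group A -> A) by exact: initial_continuous.
suff : nbhs (val u) [set b | dist (val u) b < e] by exact: cv.
by apply/nbhs_distP; exists e; split.
Qed.

Section threshold.
Context (R : realType) (X : topologicalType) (d : X -> X -> R).
Context (Q : X -> R -> Prop).

Definition safe (x : X) : set R :=
  [set r | [/\ 0 < r, r <= 1 &
     forall y t, d x y < r -> r^-1 <= t -> Q y t]].

(** The supremum of the safe radii is [1]-Lipschitz, because a radius [r] that
    is safe at [x] leaves a safe radius [r - d x y] at [y]: its inverse is a
    continuous majorant of a locally bounded threshold, without any appeal to a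
    partition of unity.  The factor [2] is there because the supremum itself
    need not be safe. *)
Definition threshold (x : X) : R := 2 / sup (safe x).

Context (metd : metrises d).
Context (evQ : forall x : X, \forall y \near x & t \near +oo, Q y t).

Let dC : forall x y, d x y = d y x. Proof. by case: metd. Qed.
Let d_triangle : forall y x z, d x z <= d x y + d y z.
Proof. by case: metd. Qed.
Let dP x (U : set X) : nbhs x U <->
  exists e : R, 0 < e /\ [set y | d x y < e] `<=` U.
Proof. by case: metd. Qed.

Let dxx x (e : R) : 0 < e -> d x x < e.
Proof.
move=> e0; suff /nbhs_singleton : nbhs x [set y | d x y < e] by [].
by apply/dP; exists e; split.
Qed.

Lemma safe_neq0 x : safe x !=set0.
Proof.
have [[U V] /= [/dP[e [e0 eU]] [M [_ MV]]] UV] := evQ x.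
pose r := Num.min (Num.min 1 e) (`|M| + 1)^-1.
have M0 : 0 < `|M| + 1 by rewrite ltr_wpDl.
have r0 : 0 < r by rewrite !lt_min ltr01 e0 invr_gt0.
exists r; split => //; first by rewrite !ge_min lexx.
move=> y t xy rt; apply: (UV (y, t)); split => /=.
  by apply/eU/(lt_le_trans xy); rewrite !ge_min lexx orbT.
apply: MV; apply: lt_le_trans rt.
apply: (le_lt_trans (ler_norm M)); apply: (@lt_le_trans _ _ (`|M| + 1)).
  by rewrite ltrDl.
by rewrite -[leLHS]invrK lef_pV2 ?posrE ?invr_gt0// ge_min lexx orbT.
Qed.

Lemma safe_has_sup x : has_sup (safe x).
Proof. by split; [exact: safe_neq0|exists 1 => r []]. Qed.

Lemma sup_safe_gt0 x : 0 < sup (safe x).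
Proof.
have [r sr] := safe_neq0 x; have [r0 _ _] := sr.
by apply: (lt_le_trans r0); apply: ub_le_sup sr; case: (safe_has_sup x).
Qed.

Lemma sup_safe_lipschitz x y : sup (safe x) <= sup (safe y) + d x y.
Proof.
apply: ge_sup; first exact: safe_neq0.
move=> r [r0 r1 sr]; have [ry|ry] := leP r (d x y).
  by apply: (le_trans ry); rewrite lerDr ltW ?sup_safe_gt0.
rewrite -lerBlDr; apply: ub_le_sup; first by case: (safe_has_sup y).
have d_ge0 : 0 <= d x y.
  by have := d_triangle x x x; have := d_triangle y x x; rewrite (dC y x); lra.
split; [by rewrite subr_gt0|lra|].
move=> z t yz rt; apply: sr.
  by apply: le_lt_trans (d_triangle y _ _) _; lra.
by apply: le_trans rt; rewrite lef_pV2 ?posrE ?subr_gt0//; lra.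
Qed.

Lemma threshold_continuous : continuous threshold.
Proof.
move=> x; apply: cvgM; first exact: cvg_cst.
apply: cvgV; first by rewrite gt_eqF ?sup_safe_gt0.
apply/cvgrPdist_lt => e e0; apply/dP; exists e; split => // y /= xy.
have := sup_safe_lipschitz x y; have := sup_safe_lipschitz y x.
by rewrite (dC y x) ltr_norml; lra.
Qed.

Lemma threshold_gt0 x : 0 < threshold x.
Proof. by rewrite divr_gt0 ?sup_safe_gt0. Qed.

Lemma thresholdP x t : threshold x <= t -> Q x t.
Proof.
move=> xt; have s0 := sup_safe_gt0 x.
have [|r [r0 r1 sr] rs] :=
  @sup_adherent _ _ (sup (safe x) / 2) _ (safe_has_sup x).
  by rewrite divr_gt0.
apply: sr; first exact: dxx.
apply: le_trans xt; rewrite /threshold -[2]invrK -invfM.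
by rewrite lef_pV2 ?posrE ?mulr_gt0 ?invr_gt0//; lra.
Qed.

Lemma threshold_le x y : safe x `<=` safe y -> threshold y <= threshold x.
Proof.
move=> sxy; rewrite ler_pM2l// lef_pV2 ?posrE ?sup_safe_gt0//.
apply: ge_sup; first exact: safe_neq0.
by move=> r /sxy; apply: ub_le_sup; case: (safe_has_sup y).
Qed.

End threshold.

(** * Asymptotic morphisms near a unitary *)

Section late_times.
Context (R : realType).

Lemma nbhs_pinfty_ge0 : \forall t \near +oo, 0 <= (t : R).
Proof. by apply: nbhs_pinfty_ge; exact: num_real. Qed.

Lemma near_late (X : topologicalType) (x : X) (P : R -> Prop) :
  (\forall t \near +oo, P t) -> \forall y \near x & t \near +oo, P t.
Proof.
move=> Pt; exists (setT, P); first by split => //; exact: filterT.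
by move=> [y t] [].
Qed.

Lemma near_at (X : topologicalType) (x : X) (P : X -> R -> Prop) :
  (\forall y \near x & t \near +oo, P y t) -> \forall t \near +oo, P x t.
Proof.
move=> [[U V] /= [Ux Vt] UV]; apply: filterS Vt => t Vt.
by apply: (UV (x, t)); split => //; exact: nbhs_singleton Ux.
Qed.

End late_times.

Section near_unitary.
Context (R : realType) (A B : mlcStarAlgType R) (k : R -> A -> B).
Context (k_pbam : pbam k).
Implicit Types (a v : A) (n : nat).

Lemma snorm_nbhs0 n (e : R) : 0 < e -> nbhs (0 : B) [set b | snorm n b < e].
Proof.
by move=> e0; apply/nbhs_snormP; exists n, e; split => // b /=; rewrite subr0.
Qed.

Lemma dist_snorm n (e : R) : 0 < e -> exists d : R, 0 < d /\
  forall b b' : B, dist b b' < d -> snorm n (b' - b) < e.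
Proof.
move=> e0; have /nbhs_distP[d [d0 dU]] := snorm_nbhs0 n e0.
by exists d; split => // b b'; rewrite dist0; exact: dU.
Qed.

Lemma cvg0_snorm (F : R -> B) n (e : R) : F t @[t --> +oo] --> (0 : B) ->
  0 < e -> \forall t \near +oo, snorm n (F t) < e.
Proof. by move=> F0 e0; exact: (F0 _ (snorm_nbhs0 n e0)). Qed.

Lemma pbam_near_dist v (e : R) : 0 < e ->
  \forall v' \near v & t \near +oo, dist (k t v) (k t v') < e.
Proof.
move=> e0; have [eta [P [eta0 P0 kP]]] := pbam_sac k_pbam v e0.
exists ([set v' | dist v v' < eta], [set t | P <= t]) => /=.
  split; first by apply/nbhs_distP; exists eta; split.
  by apply: nbhs_pinfty_ge; exact: num_real.
by move=> [v' t] /= [vv' Pt]; exact: kP.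
Qed.

Lemma pbam_near v n (e : R) : 0 < e ->
  \forall v' \near v & t \near +oo, snorm n (k t v' - k t v) < e.
Proof.
move=> e0; have [d [d0 dU]] := dist_snorm n e0.
by apply: filterS (pbam_near_dist v d0) => -[v' t]; exact: dU.
Qed.

Lemma pbam_bounded_near v n : exists M,
  \forall v' \near v & t \near +oo, snorm n (k t v') <= M.
Proof.
have [M kM] := pbam_bounded k_pbam v n; exists (M + 1).
apply: filterS2 (near_late v (nbhs_pinfty_ge0 R)) (pbam_near v n ltr01).
move=> [v' t] /= t0 vt.
have := snormD n (k t v' - k t v) (k t v); rewrite subrK.
by have := kM t t0; lra.
Qed.

Lemma pbam_zero n (e : R) : 0 < e -> \forall t \near +oo, snorm n (k t 0) < e.
Proof.
move=> e0; have := cvg0_snorm n (pbam_scale k_pbam 0 0) e0.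
by apply: filterS => t; rewrite !scale0r sub0r snormN.
Qed.

Lemma pbam_bullet a a' n (e : R) : 0 < e -> \forall t \near +oo,
  snorm n (bullet (k t a) (k t a') - k t (bullet a a')) < e.
Proof.
move=> e0; have e3 : 0 < e / 3 by rewrite divr_gt0.
have k1 := cvg0_snorm n (pbam_add k_pbam a a') e3.
have k2 := cvg0_snorm n (pbam_mul k_pbam a a') e3.
have k3 := cvg0_snorm n (pbam_add k_pbam (a + a') (amul a a')) e3.
apply: filterS3 k1 k2 k3 => t k1 k2 k3.
rewrite /bullet; set x := k t (a + a') in k1 k3 *.
set y := k t (amul a a') in k2 k3 *.
set z := k t (_ + amul a a') in k3 *.
have -> : k t a + k t a' + amul (k t a) (k t a') - z =
    (k t a + k t a' - x) + ((amul (k t a) (k t a') - y) + (x + y - z)).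
  rewrite [RHS](AC (3*(2*3)) (((1*2*4)*8)*(3*6)*(5*7))) /=.
  by rewrite addNr addr0 addNr addr0.
have := snormD n (k t a + k t a' - x)
  ((amul (k t a) (k t a') - y) + (x + y - z)).
have := snormD n (amul (k t a) (k t a') - y) (x + y - z).
by lra.
Qed.

(** Replacing [k t (star v)] by [star (k t v)] costs a product with the bounded
    element [k t v], whence the appeal to boundedness. *)
Lemma pbam_star_bullet v n (e : R) : 0 < e -> \forall t \near +oo,
  snorm n (bullet (k t v) (star (k t v)) - k t (bullet v (star v))) < e /\
  snorm n (bullet (star (k t v)) (k t v) - k t (bullet (star v) v)) < e.
Proof.
move=> e0; have [M kM] := pbam_bounded k_pbam v n.+1.
have M0 : 0 <= M by apply: le_trans (kM 0 _); rewrite ?snorm_ge0.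
have M2 : 0 < M + 2 by lra.
pose d := e / 2 / (M + 2); have d0 : 0 < d by rewrite !divr_gt0.
have dE : (M + 2) * d = e / 2 by rewrite mulrC divfK// gt_eqF.
have e2 : 0 < e / 2 by rewrite divr_gt0.
have ks := cvg0_snorm n.+1 (pbam_star k_pbam v) d0.
apply: filterS3 (nbhs_pinfty_ge0 R) ks
  (filterI (pbam_bullet v (star v) n e2) (pbam_bullet (star v) v n e2)) => t t0.
set y := star (k t v) - k t (star v); move=> yd [k1 k2].
have -> : star (k t v) = k t (star v) + y.
  by rewrite addrC subrK.
have {}kM := kM t t0.
have yn : snorm n y < d by exact: le_lt_trans (snorm_le _ _) yd.
have bound x : snorm n x <= M * d -> snorm n (y + x) < e / 2.
  by move=> xM; apply: le_lt_trans (snormD _ _ _) _; lra.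
split.
  have -> : bullet (k t v) (k t (star v) + y) - k t (bullet v (star v)) =
      (bullet (k t v) (k t (star v)) - k t (bullet v (star v))) +
      (y + amul (k t v) y).
    by rewrite /bullet amulDr [LHS](AC (((1*2)*2)*1) (((1*2*4)*6)*(3*5))).
  apply: le_lt_trans (snormD _ _ _) _.
  suff /bound : snorm n (amul (k t v) y) <= M * d by lra.
  by apply: le_trans (snormM _ _ _) _; rewrite ler_pM ?snorm_ge0// ltW.
have -> : bullet (k t (star v) + y) (k t v) - k t (bullet (star v) v) =
    (bullet (k t (star v)) (k t v) - k t (bullet (star v) v)) +
    (y + amul y (k t v)).
  by rewrite /bullet amulDl [LHS](AC (((2*1)*2)*1) (((1*3*4)*6)*(2*5))).
apply: le_lt_trans (snormD _ _ _) _.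
suff /bound : snorm n (amul y (k t v)) <= M * d by lra.
apply: le_trans (snormM _ _ _) _.
by rewrite (mulrC M) ler_pM ?snorm_ge0// ltW.
Qed.

(** The asymptotic relations at [v] itself spread to a neighbourhood by
    strong asymptotic continuity. *)
Lemma pbam_near_unitary v n (e : R) : 0 < e -> unitaries A v ->
  \forall v' \near v & t \near +oo,
    snorm n (bullet (k t v') (star (k t v'))) < e /\
    snorm n (bullet (star (k t v')) (k t v')) < e.
Proof.
move=> e0 [vs sv]; have e3 : 0 < e / 3 by rewrite divr_gt0.
have [M kM] := pbam_bounded k_pbam v n.+3.
have [d [d0 dM]] := @bullet_star_uniform R B n M _ e3.
have kv := pbam_star_bullet v n e3; rewrite vs sv in kv.
apply: filterS3 (near_late v (filterI (nbhs_pinfty_ge0 R) (pbam_zero n e3)))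
  (near_late v kv) (pbam_near v n.+3 d0).
move=> [v' t] /= [t0 k3] [k1 k2] vt.
have [k4 k5] := dM _ _ (kM _ t0) (ltW vt).
have tri (x y z : B) : snorm n (x - y) < e / 3 -> snorm n (y - z) < e / 3 ->
    snorm n z < e / 3 -> snorm n x < e.
  move=> xy yz z0; have := snormD n (x - y) ((y - z) + z).
  by have := snormD n (y - z) z; rewrite !subrK; lra.
by split; [exact: tri k4 k1 k3|exact: tri k5 k2 k3].
Qed.

End near_unitary.

(** * The induced homotopy class *)

Section polar_maps.
Context (R : realType) (C : mlcStarAlgType R) (isr : inverse_sqrt C).
Implicit Types X : topologicalType.

Definition polar_map X (K : X -> C) (KD : forall x, polar_dom isr (K x))
    (x : X) : unitary_group C :=
  exist _ (polar isr (K x)) (mem_set (polar_unitary (KD x))).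

Lemma polar_map_continuous X (K : X -> C) (KD : forall x, polar_dom isr (K x)) :
  continuous K -> continuous (polar_map KD).
Proof.
move=> cK; apply: continuous_comp_initial.
exact: (continuous_within_comp (@polar_continuous _ _ isr) cK KD).
Qed.

(** All homotopies below are polar parts of homotopies in the vector space [C]
    that stay in the domain of [polar]. *)
Lemma homotopic_polar X (K : X -> R -> C) (w0 w1 : X -> unitary_group C) :
  continuous (fun z : X * R => K z.1 (I_clamp z.2)) ->
  (forall x p, 0 <= p <= 1 -> polar_dom isr (K x p)) ->
  (forall x, val (w0 x) = polar isr (K x 0)) ->
  (forall x, val (w1 x) = polar isr (K x 1)) ->
  homotopic R w0 w1.
Proof.
move=> cK KD w0E w1E.
have KD' (z : X * R) : polar_dom isr (K z.1 (I_clamp z.2)).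
  by apply: KD; exact: I_clamp_in.
apply/homotopicP; exists (polar_map KD'); split.
  exact: polar_map_continuous.
move=> x; split; apply: val_inj; rewrite ?w0E ?w1E /=;
  by rewrite I_clamp_id ?lexx ?ler01.
Qed.

Context (B : mlcStarAlgType R) (g : R -> B -> C).
Context (cg : {within [set x : B * R | 0 <= x.2],
  continuous (fun x => g x.2 x.1)}).

Lemma continuous_at_time X (k : X -> B) (tau : X -> R) :
  continuous k -> continuous tau -> (forall x, 0 <= tau x) ->
  continuous (fun x => g (tau x) (k x)).
Proof.
move=> ck ct t0.
exact: (continuous_within_comp cg (continuous_pair ck ct) t0).
Qed.

Lemma homotopic_time X (k : X -> B) (tau0 tau1 : X -> R)
    (w0 w1 : X -> unitary_group C) :
  continuous k -> continuous tau0 -> continuous tau1 ->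
  (forall x, 0 <= tau0 x) -> (forall x, tau0 x <= tau1 x) ->
  (forall x t, tau0 x <= t -> t <= tau1 x -> polar_dom isr (g t (k x))) ->
  (forall x, val (w0 x) = polar isr (g (tau0 x) (k x))) ->
  (forall x, val (w1 x) = polar isr (g (tau1 x) (k x))) ->
  homotopic R w0 w1.
Proof.
move=> ck c0 c1 t0 t01 gD w0E w1E.
pose tau x p := tau0 x + p * (tau1 x - tau0 x).
have tau_in x p : 0 <= p <= 1 -> tau0 x <= tau x p <= tau1 x.
  move=> /andP[p0 p1]; rewrite /tau lerDl mulr_ge0 ?subr_ge0//=.
  by rewrite -lerBrDl ler_piMl// subr_ge0.
apply: (@homotopic_polar X (fun x p => g (tau x p) (k x))).
- apply: (@continuous_at_time _ (fun z => k z.1)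
    (fun z => tau z.1 (I_clamp z.2))).
  + exact: continuous_compose ck (@fst_continuous _ _).
  + have c0' := continuous_compose c0 (@fst_continuous X R).
    have c1' := continuous_compose c1 (@fst_continuous X R).
    apply: continuous_addR => //; apply: continuous_mulR.
      exact: continuous_compose (@I_clamp_continuous R) (@snd_continuous _ _).
    by move=> z; apply: cvgB; [exact: c1'|exact: c0'].
  + move=> z; have /andP[h _] := tau_in z.1 _ (I_clamp_in z.2).
    exact: le_trans (t0 _) h.
- by move=> x p /(tau_in x)/andP[? ?]; exact: gD.
- by move=> x; rewrite w0E /tau mul0r addr0.
- by move=> x; rewrite w1E /tau mul1r addrC subrK.
Qed.

End polar_maps.

Section unitary_group.
Context (R : realType) (A : mlcStarAlgType R).
Implicit Type v : unitary_group A.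

Lemma unitary_groupP v : unitaries A (val v).
Proof. exact: set_mem (valP v). Qed.

Lemma unitary_val_continuous : continuous (fun v => val v : A).
Proof. exact: initial_continuous. Qed.

Lemma near_unitary_group v (P : A -> R -> Prop) :
  (\forall a \near val v & t \near +oo, P a t) ->
  \forall w \near v & t \near +oo, P (val w) t.
Proof.
move=> [[U V] /= [Uv Vt] UV]; exists (val @^-1` U, V).
  by split => //=; exact: unitary_val_continuous.
by move=> [w t] [/= Uw Vt']; exact: (UV (val w, t)).
Qed.

Lemma continuous_threshold (P : unitary_group A -> R -> Prop) :
  (forall v, \forall w \near v & t \near +oo, P w t) ->
  exists tau : unitary_group A -> R,
    [/\ continuous tau, forall v, 0 <= tau v & forall v t, tau v <= t -> P v t].
Proof.
move=> evP; have metU := metrises_unitary_group A.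
exists (threshold (fun u v => dist (val u) (val v)) P); split.
- exact: threshold_continuous metU evP.
- by move=> v; apply: ltW; exact: threshold_gt0 metU evP v.
- by move=> v t vt; exact: (thresholdP metU evP vt).
Qed.

End unitary_group.

Section induced_homotopy_class.
Context (R : realType) (A B : mlcStarAlgType R) (isr : inverse_sqrt B).
Context (f : R -> A -> B) (f_pbam : pbam f).

Lemma near_polar_dom (v : A) : unitaries A v ->
  \forall a \near v & t \near +oo, polar_dom isr (f t a).
Proof.
move=> uv; have [n [e [e0 eD]]] := polar_domP isr.
apply: filterS (pbam_near_unitary f_pbam n e0 uv) => -[a t] /= [].
exact: eD.
Qed.

Lemma near_polar (v : A) (e : R) : unitaries A v -> 0 < e ->
  \forall a \near v & t \near +oo, dist (f t a) (polar isr (f t a)) < e.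
Proof.
move=> uv e0; have : nbhs (0 : B) [set b | dist 0 b < e].
  by apply/nbhs_distP; exists e; split.
move=> /nbhs_snormP[m [e' [e'0 ee']]].
have [M fM] := pbam_bounded_near f_pbam v m.+1.
have [n [d [d0 near_d]]] := polar_near isr m M e'0.
apply: filterS3 (near_polar_dom uv) fM (pbam_near_unitary f_pbam n d0 uv).
move=> [a t] /= D zM [_ zd]; rewrite dist0; apply: ee' => /=; rewrite subr0.
exact: near_d.
Qed.

Lemma admissible_exists : exists alpha, admissible isr f alpha.
Proof.
have [|alpha [ca a0 aD]] :=
  @continuous_threshold R A (fun v t => polar_dom isr (f t (val v))).
  move=> v.
  apply: (@near_unitary_group R A v (fun a t => polar_dom isr (f t a))).
  exact/near_polar_dom/unitary_groupP.
by exists alpha; split.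
Qed.

Section ftilde_map.
Context (alpha : unitary_group A -> R) (adm : admissible isr f alpha).

Lemma admissible_dom v : polar_dom isr (f (alpha v) (val v)).
Proof. by case: adm => _ _; apply. Qed.

Definition ftilde_map : unitary_group A -> unitary_group B :=
  polar_map admissible_dom.

Lemma ftilde_map_continuous : continuous ftilde_map.
Proof.
have [ca a0 _] := adm; apply: polar_map_continuous.
apply: (continuous_at_time (pbam_continuous f_pbam)) => //.
exact: unitary_val_continuous.
Qed.

Definition ftilde_cts : continuousType (unitary_group A) (unitary_group B) :=
  mkcts ftilde_map_continuous.

End ftilde_map.

Lemma homotopic_ftilde_le alpha beta
    (adma : admissible isr f alpha) (admb : admissible isr f beta) :
  (forall v, alpha v <= beta v) ->
  homotopic R (ftilde_map adma) (ftilde_map admb).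
Proof.
move=> ab; have [ca a0 aD] := adma; have [cb b0 _] := admb.
apply: (@homotopic_time _ _ isr _ _ (pbam_continuous f_pbam) (unitary_group A)
  (fun v => val v) alpha beta) => //.
- exact: unitary_val_continuous.
- by move=> v t vt _; exact: aD.
Qed.

(** Two admissible reparameterisations are compared through their sum, which
    lies above both. *)
Lemma homotopic_ftilde alpha beta
    (adma : admissible isr f alpha) (admb : admissible isr f beta) :
  homotopic R (ftilde_map adma) (ftilde_map admb).
Proof.
have [ca a0 aD] := adma; have [cb b0 _] := admb.
have admab : admissible isr f (fun v => alpha v + beta v).
  split=> [|v|v t vt]; [exact: continuous_addR|exact: addr_ge0|].
  by apply: aD; apply: le_trans vt; rewrite lerDl.
apply: homotopic_trans (homotopic_sym (homotopic_ftilde_le admb admab _)).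
  by apply: homotopic_ftilde_le => v; rewrite lerDl.
by move=> v; rewrite lerDr.
Qed.

Lemma induced_classE alpha (adm : admissible isr f alpha) :
  induced_class isr f = homotopy_class R (ftilde_cts adm).
Proof.
apply/seteqP; split=> [w [beta [u [admb uE uw]]]|w uw]; last first.
  by exists alpha, (ftilde_cts adm).
apply: homotopic_trans (homotopic_ftilde adm admb) _.
suff <- : u = ftilde_map admb :> (_ -> _) by [].
by apply/funext => v; apply: val_inj; rewrite uE.
Qed.

End induced_homotopy_class.

(** * Uniformity over all later times of the second morphism *)

Section late_reparameterisations.
Context (R : realType).

(** The threshold of a monotone condition is monotone, so it serves as a
    reparameterisation. *)
Lemma reparameterisation_majorant (phi : R -> R) (t_ r_ : nat -> R) :
  reparameterisation phi -> (forall n, n%:R <= t_ n) ->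
  exists theta, [/\ reparameterisation theta,
    forall t, 0 <= t -> phi t < theta t & forall n, r_ n <= theta (t_ n)].
Proof.
move=> [cphi phi0 phi_le] t_ge.
pose Q (y s : R) := forall n, n%:R <= y -> r_ n <= s.
pose d (x y : R) := `|x - y|.
have metd : metrises d := metrises_real R.
have evQ (x : R) : \forall y \near x & s \near +oo, Q y s.
  pose N := Num.bound (`|x| + 1); pose M := \sum_(n < N) `|r_ n|.
  exists ([set y | `|x - y| < 1], [set s | M <= s]) => /=.
    split; first exact: (@nbhsx_ballx _ R x 1).
    by apply: nbhs_pinfty_ge; exact: num_real.
  move=> [y s] /= [xy Ms] n ny; have nN : (n < N)%N.
    rewrite -(ltr_nat R); apply: (le_lt_trans ny).
    apply: lt_trans (archi_boundP _); last by rewrite addr_ge0.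
    by have := ler_norm x; have := ler_norm (y - x); rewrite (distrC y x); lra.
  apply: le_trans Ms; apply: (le_trans (ler_norm _)).
  rewrite /M (bigD1 (Ordinal nN))//= lerDl.
  by apply: sumr_ge0.
pose theta t := phi t + threshold d Q t.
have th_gt0 t : 0 < threshold d Q t by exact: threshold_gt0 metd evQ t.
exists theta; split; first split.
- move=> t; apply: cvgD; first exact: cphi.
  by apply: (continuous_subspaceT (threshold_continuous metd evQ)).
- by move=> t t0; rewrite addr_ge0 ?phi0// ltW.
- move=> s t s0 st; rewrite lerD ?phi_le//.
  apply: (threshold_le metd evQ) => r [r0 r1 sr]; split => // y u sy ru n ny.
  apply: (sr (y + (t - s)) u _ ru n).
    by rewrite /d (_ : _ - _ = s - y)//; ring.
  by apply: (le_trans ny); rewrite lerDl subr_ge0.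
- by move=> t t0; rewrite ltrDl.
move=> n; have t0 : 0 <= t_ n by exact: le_trans (t_ge n).
apply: (@le_trans _ _ (threshold d Q (t_ n))); last by rewrite lerDr phi0.
exact: (thresholdP metd evQ (lexx _) n (t_ge n)).
Qed.

(** Validity only concerns reparameterisations of [t]; but were some times
    [r >= phi t] bad for arbitrarily late [t], arbitrarily close to [v], a
    sequence of them would lie below a single reparameterisation [theta], and
    the homotopy attached to [theta] passes through all of them. *)
Lemma comp_near_unitary (A B C : mlcStarAlgType R)
    (f : R -> A -> B) (g : R -> B -> C) phi (v : A) n (e : R) :
  valid_reparameterisation f g phi -> unitaries A v -> 0 < e ->
  \forall a \near v & t \near +oo, forall r, phi t <= r ->
    snorm n (bullet (g r (f t a)) (star (g r (f t a)))) < e /\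
    snorm n (bullet (star (g r (f t a))) (g r (f t a))) < e.
Proof.
move=> [rep_phi _ valid] uv e0; apply: contrapT => not_near.
pose small (z : C) :=
  snorm n (bullet z (star z)) < e /\ snorm n (bullet (star z) z) < e.
pose bad m (x : A * R * R) := [/\ dist v x.1.1 < m.+1%:R^-1, m%:R <= x.1.2,
  phi x.1.2 <= x.2 & ~ small (g x.2 (f x.1.2 x.1.1))].
have /choice[x xbad] : forall m, exists x, bad m x.
  move=> m; apply: contrapT => no_bad; apply: not_near.
  exists ([set a | dist v a < m.+1%:R^-1], [set t | m%:R <= t]) => /=.
    split; first by apply/nbhs_distP; exists m.+1%:R^-1; split.
    by apply: nbhs_pinfty_ge; exact: num_real.
  move=> [a t] /= [va mt] r tr; apply: contrapT => z_bad.
  by apply: no_bad; exists (a, t, r).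
have x_late m : m%:R <= (x m).1.2 by case: (xbad m).
have [theta [rep_theta phi_theta x_theta]] :=
  reparameterisation_majorant (fun m => (x m).2) rep_phi x_late.
have [_ [h [[h_pbam _] hE]]] := valid theta rep_theta
  (fun t t0 => ltW (phi_theta t t0)).
have [[U V] /= [/nbhs_distP[d [d0 dU]] [M [_ MV]]] UV] :=
  pbam_near_unitary h_pbam n e0 uv.
pose m := Num.bound (`|M| + d^-1).
have mM : `|M| + d^-1 < m%:R.
  by apply: archi_boundP; rewrite addr_ge0// invr_ge0 ltW.
have di0 : 0 < d^-1 by rewrite invr_gt0.
have [xd xt xr] := xbad m; apply.
move: (x m) xd xt xr (x_theta m) => [[a t] r] /= va mt tr rth.
have t0 : 0 <= t by exact: le_trans mt.
have UVat : U a /\ V t.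
  split; last by apply: MV; have := ler_norm M; lra.
  apply: dU; apply: (lt_trans va); rewrite -[ltRHS]invrK ltf_pV2 ?posrE//.
  by have := normr_ge0 M; rewrite -[m.+1]addn1 natrD; lra.
(* The parameter at which the homotopy runs through the bad time [r]. *)
pose p := (theta t - r) / (theta t - phi t).
have den : 0 < theta t - phi t by rewrite subr_gt0 phi_theta.
have p01 : 0 <= p <= 1.
  rewrite /p divr_ge0 ?subr_ge0 ?(ltW (phi_theta t t0))//=.
  by rewrite ler_pdivrMr//; lra.
have pE : p * phi t + (1 - p) * theta t = r.
  have : p * (theta t - phi t) = theta t - r by rewrite divfK// gt_eqF.
  by lra.
have hp : C01_fun (h t a) (I_proj p) = g r (f t a).
  by rewrite [LHS]hE//= I_clamp_id// pE.
have /= [h1 h2] := UV (a, t) UVat; rewrite -hp; split.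
  exact: le_lt_trans (le_C01_snorm n (bullet (h t a) (star (h t a))) _) h1.
exact: le_lt_trans (le_C01_snorm n (bullet (star (h t a)) (h t a)) _) h2.
Qed.

End late_reparameterisations.

(** * Functoriality *)

Section composition.
Context (R : realType).

Lemma real_complex_continuous : continuous (fun x : R => x%:C : R[i]^o).
Proof.
move=> x; apply/cvgrPdist_lt => e e0.
have eE : e = (complex.Re e)%:C.
  by case: e e0 => a b; rewrite ltcE /= => /andP[/eqP -> _].
have e0' : 0 < complex.Re e by rewrite -ltcR -eE.
near=> y.
rewrite -rmorphB /= normc_def /= expr0n /= addr0 sqrtr_sqr eE ltcR.
near: y; exact: (@nbhsx_ballx _ R x (complex.Re e)).
Unshelve. all: by end_near. Qed.

Lemma continuous_segment (C : mlcStarAlgType R) (X : topologicalType)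
    (x y : X -> C) (p : X -> R) :
  continuous x -> continuous y -> continuous p ->
  continuous (fun z => x z + (p z)%:C *: (y z - x z)).
Proof.
move=> cx cy cp.
have add (k l : X -> C) : continuous k -> continuous l ->
    continuous (fun z => k z + l z).
  move=> ck cl; apply: (@continuous2_comp X C C C _ _ (fun a b => a + b)) => //.
  exact: tvs.add_continuous.
apply: (add) => //.
apply: (@continuous2_comp X R[i]^o C C _ _ (fun a b => a *: b)).
- exact: continuous_compose real_complex_continuous cp.
- apply: (add) => //; apply: continuous_compose cx.
  exact: tvs.opp_continuous.
- exact: tvs.scale_continuous.
Qed.

Context (A B C : mlcStarAlgType R).
Context (isrB : inverse_sqrt B) (isrC : inverse_sqrt C).
Context (f : R -> A -> B) (g : R -> B -> C) (phi : R -> R).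
Context (f_pbam : pbam f) (g_pbam : pbam g).
Context (fg_C1 : condition_C1 f g) (fg_C3 : condition_C3 f g).
Context (phi_valid : valid_reparameterisation f g phi).

(** At late times of [g], the segment between the images of two points close to
    [f t a] stays in the domain of [polar].  The radius is asked to exceed the
    distance from [f t a] to its polar part, which is the second point to which
    this is applied. *)
Definition segment_stable (a : A) (t : R) : Prop := exists S xi : R,
  [/\ 0 < xi, dist (f t a) (polar isrB (f t a)) < xi &
    forall b b' s p, S <= s -> dist (f t a) b < xi -> dist (f t a) b' < xi ->
      0 <= p <= 1 -> polar_dom isrC (g s b + p%:C *: (g s b' - g s b))].

(** [condition_C1] puts both ends of the segment close to [z = g s (f t v)],
    which is almost unitary and, by [condition_C3], bounded independently of
    the late time [s]: the whole segment is then almost unitary. *)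
Lemma near_segment_stable (v : A) : unitaries A v ->
  \forall a \near v & t \near +oo, segment_stable a t.
Proof.
move=> uv; have [n [e [e0 eD]]] := polar_domP isrC.
have e2 : 0 < e / 2 by rewrite divr_gt0.
have [Q3 [M [Q30 M0 gM]]] := fg_C3 v n.+3.
have [d [d0 dM]] := @bullet_star_uniform R C n M _ e2.
have d3 : 0 < d / 3 by rewrite divr_gt0.
have [nu [nu0 nud]] := @dist_snorm R C n.+3 _ d3.
have [xi [Q1 [xi0 Q10 gxi]]] := fg_C1 v nu0.
have xi2 : 0 < xi / 2 by rewrite divr_gt0.
have late Q0 : \forall t \near +oo, Q0 <= (t : R).
  by apply: nbhs_pinfty_ge; exact: num_real.
have uz := comp_near_unitary n phi_valid uv e2.
apply: filterS3 (filterI (near_late v (filterI (late Q3) (late Q1)))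
  (near_late v (near_at uz))) (pbam_near_dist f_pbam v xi2)
  (near_polar isrB f_pbam uv xi2).
move=> [a t] /= [[tQ3 tQ1] tz] va fa.
have [S3 [_ gS3]] := gM t tQ3; have [S1 [_ gS1]] := gxi t tQ1.
exists (Num.max (Num.max S3 S1) (phi t)), (xi / 2); split=> // b b' s p.
rewrite !ge_max => /andP[/andP[sS3 sS1] sphi] ab ab' /andP[p0 p1].
have close c : dist (f t a) c < xi / 2 ->
    snorm n.+3 (g s c - g s (f t v)) < d / 3.
  move=> ac; apply/nud/gS1 => //.
  by have := dist_triangle (f t a) (f t v) c; lra.
have [z1 z2] := tz s sphi; set z := g s (f t v) in close z1 z2.
have [] := dM z (g s b + p%:C *: (g s b' - g s b)) (gS3 s sS3).
  have /close bz := ab; have /close bz' := ab'.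
  rewrite addrAC; apply: (le_trans (snormD _ _ _)).
  rewrite snormZr normc_def /= expr0n /= addr0 sqrtr_sqr ger0_norm//.
  have : snorm n.+3 (g s b' - g s b) <= d / 3 + d / 3.
    have := snormD n.+3 (g s b' - z) (z - g s b).
    by rewrite subrKA -(opprB _ z) snormN; lra.
  have := snorm_ge0 n.+3 (g s b' - g s b).
  by move: (snorm _ (g s b' - g s b)) => x x0 xd; have := ler_piMl x0 p1; lra.
move: (g s b + _) => y y1 y2; apply: eD.
  have := snormD n (bullet y (star y) - bullet z (star z)) (bullet z (star z)).
  by rewrite subrK; lra.
have := snormD n (bullet (star y) y - bullet (star z) z) (bullet (star z) z).
by rewrite subrK; lra.
Qed.

(** One time [alpha] serves both [f] and the composite, and the two
    representatives are joined by the three homotopies described above; the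
    continuous time [s] at which the segment is followed lies above the times
    of both representatives. *)
Lemma admissible_composition : exists (alpha : unitary_group A -> R)
    (beta : unitary_group B -> R)
    (adma : admissible isrB f alpha) (admb : admissible isrC g beta)
    (admc : admissible isrC (pbam_comp g phi f) alpha),
  homotopic R (ftilde_map admc) (ftilde_map admb \o ftilde_map adma).
Proof.
have [rep_phi _ _] := phi_valid; have [cphi phi0 _] := rep_phi.
have [nC [eC [eC0 eCD]]] := polar_domP isrC.
pose P (v : unitary_group A) t := [/\ polar_dom isrB (f t (val v)),
  forall r, phi t <= r -> polar_dom isrC (g r (f t (val v))) &
  segment_stable (val v) t].
have [|alpha [ca a0 aP]] := @continuous_threshold R A P.
  move=> v; have uv := unitary_groupP v.
  apply: filterS3 (near_unitary_group (near_polar_dom isrB f_pbam uv))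
    (near_unitary_group (comp_near_unitary nC phi_valid uv eC0))
    (near_unitary_group (near_segment_stable uv)).
  move=> [w t] /= D1 D2 D3; split => // r tr.
  by have [] := D2 r tr; exact: eCD.
have [beta admb] := admissible_exists isrC g_pbam; have [cb b0 bD] := admb.
have adma : admissible isrB f alpha.
  by split => // v t vt; have [] := aP v t vt.
have admc : admissible isrC (pbam_comp g phi f) alpha.
  by split => // v t vt; have [_ D _] := aP v t vt; exact: D.
exists alpha, beta, adma, admb, admc.
pose u := ftilde_map adma; pose b v := f (alpha v) (val v).
have cu : continuous u by exact: ftilde_map_continuous.
have cb' : continuous (fun v => val (u v) : B).
  exact: continuous_compose (@unitary_val_continuous R B) cu.
have cf : continuous b.
  apply: (continuous_at_time (pbam_continuous f_pbam)) => //.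
  exact: unitary_val_continuous.
have cpa : continuous (phi \o alpha).
  by apply: (continuous_within_comp cphi ca) => v; rewrite /= in_itv /= a0.
have pa0 v : 0 <= phi (alpha v) by exact: phi0.
pose L v s p := g s (b v) + p%:C *: (g s (val (u v)) - g s (b v)).
pose stable v s := forall p, 0 <= p <= 1 -> polar_dom isrC (L v s p).
have [|s1 [cs1 s10 s1P]] := @continuous_threshold R A stable.
  move=> v; have [_ _ [S [xi [xi0 bxi sxi]]]] := aP v _ (lexx _).
  have ball : nbhs (b v) [set c | dist (b v) c < xi].
    by apply/nbhs_distP; exists xi; split.
  (* The strict bound on [dist (b v) (val (u v))] keeps [u w] in range too. *)
  have ball' : nbhs (val (u v)) [set c | dist (b v) c < xi].
    have h : 0 < xi - dist (b v) (val (u v)) by rewrite subr_gt0.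
    apply/nbhs_distP; exists (xi - dist (b v) (val (u v))); split => // c /= uc.
    by apply: le_lt_trans (dist_triangle (val (u v)) _ _) _; lra.
  exists ([set w | dist (b v) (b w) < xi] `&`
      [set w | dist (b v) (val (u w)) < xi], [set s | S <= s]) => /=.
    split; first by apply: filterI; [exact: cf ball|exact: cb' ball'].
    by apply: nbhs_pinfty_ge; exact: num_real.
  by move=> [w s] /= [[wb wu] Ss] p p01; exact: sxi.
(* A sum rather than a maximum, all three times being nonnegative. *)
pose s v := s1 v + (beta (u v) + phi (alpha v)).
have cs : continuous s.
  apply: (continuous_addR cs1); apply: continuous_addR cpa.
  exact: continuous_compose cb cu.
have bs v : beta (u v) <= s v.
  by have := s10 v; have := pa0 v; rewrite /s; lra.
have ps v : phi (alpha v) <= s v.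
  by have := s10 v; have := b0 (u v); rewrite /s; lra.
have ss v : s1 v <= s v.
  by have := pa0 v; have := b0 (u v); rewrite /s; lra.
have s0 v : 0 <= s v by exact: le_trans (ss v).
have gc := pbam_continuous g_pbam.
have D0 v : polar_dom isrC (g (s v) (b v)).
  by have [_ D _] := aP v _ (lexx _); exact: D.
have D1 v : polar_dom isrC (g (s v) (val (u v))).
  exact: bD (bs v).
have late_b : homotopic R (ftilde_map admc) (polar_map D0).
  apply: (@homotopic_time R C isrC B g gc (unitary_group A) b
    (phi \o alpha) s) => //.
  by move=> v t pt _; have [_ D _] := aP v _ (lexx _); exact: D.
have segment : homotopic R (polar_map D0) (polar_map D1).
  apply: (@homotopic_polar R C isrC (unitary_group A) (fun v p => L v (s v) p)).
  - apply: (@continuous_segment C _ (fun z => g (s z.1) (b z.1))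
      (fun z => g (s z.1) (val (u z.1))) (fun z => I_clamp z.2)).
    + exact: continuous_compose (continuous_at_time gc cf cs s0)
        (@fst_continuous _ _).
    + exact: continuous_compose (continuous_at_time gc cb' cs s0)
        (@fst_continuous _ _).
    + exact: continuous_compose (@I_clamp_continuous R) (@snd_continuous _ _).
  - by move=> v p; apply: s1P.
  - by move=> v; rewrite /L scale0r addr0.
  - by move=> v; rewrite /L scale1r addrC subrK.
have late_u : homotopic R (ftilde_map admb \o u) (polar_map D1).
  apply: (@homotopic_time R C isrC B g gc (unitary_group A) (fun v => val (u v))
    (beta \o u) s) => //.
  - exact: continuous_compose cb cu.
  - by move=> v; exact: b0.
  - by move=> v t bt _; exact: bD bt.
apply: (homotopic_trans late_b); apply: (homotopic_trans segment).
exact: homotopic_sym.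
Qed.

End composition.

Lemma comp_class_homotopy_class (R : realType) (X Y Z : topologicalType)
    (w1 : continuousType X Y) (w2 : continuousType Y Z)
    (w : continuousType X Z) :
  homotopic R w (w2 \o w1) ->
  homotopy_class R w = comp_class R (homotopy_class R w2) (homotopy_class R w1).
Proof.
move=> ww; apply/seteqP; split=> [w' ww'|w' [w2' [w1' [w22 w11 ww']]]].
  exists w2, w1; split; [| |exact: homotopic_trans (homotopic_sym ww) ww'].
  - by apply: homotopic_refl; exact: cts_fun.
  - by apply: homotopic_refl; exact: cts_fun.
apply: (homotopic_trans ww); apply: homotopic_trans ww'.
exact: homotopic_comp.
Qed.

Theorem theorem8p6 (R : realType) (A B C : smlcStarAlgType R)
    (isrB : inverse_sqrt B) (isrC : inverse_sqrt C)
    (f : R -> A -> B) (g : R -> B -> C) (phi : R -> R)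
    (f_pbam : pbam f) (g_pbam : pbam g)
    (fg_C1 : condition_C1 f g) (fg_C3 : condition_C3 f g)
    (phi_valid : valid_reparameterisation f g phi) :
  homotopy_classes R (unitary_group A) (unitary_group C)
    (induced_class isrC (pbam_comp g phi f)) /\
  induced_class isrC (pbam_comp g phi f) =
    comp_class R (induced_class isrC g) (induced_class isrB f).
Proof.
have [_ comp_pbam _] := phi_valid.
have [alpha [beta [adma [admb [admc]]]]] :=
  admissible_composition isrB isrC f_pbam g_pbam fg_C1 fg_C3 phi_valid.
rewrite (induced_classE comp_pbam admc) (induced_classE f_pbam adma).
rewrite (induced_classE g_pbam admb) => ww; split.
  by exists (ftilde_cts comp_pbam admc).
exact: comp_class_homotopy_class.
Qed.
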